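(* Fix a semantic context $\boldsymbol{\Omega}$ and a feasible policy $\pi\in\Pi$, and let all information quantities be computed under the joint distribution of $(U_{\rm c},U_{\rm s},E,P_{\rm phy},X,Y_{\rm c},Y_{\rm s})$ induced by $\pi$ under the physical observation models described in the context. Suppose that this distribution satisfies the Markov chain $U_{\rm c}\to X\to Y_{\rm c}$ and the sensing relation $I_\pi(U_{\rm s};Y_{\rm s}\mid P_{\rm phy},X)=0$. Define $$\mathcal{I}_{\rm c}^{\rm sem}(\pi)=I_\pi(U_{\rm c};Y_{\rm c}),\quad \mathcal{I}_{\rm s}^{\rm sem}(\pi)=I_\pi(U_{\rm s};Y_{\rm s}\mid X),\quad \mathcal{I}_{\rm c}^{\rm phy}(\pi)=I_\pi(X;Y_{\rm c}),\quad \mathcal{I}_{\rm s}^{\rm phy}(\pi)=I_\pi(P_{\rm phy};Y_{\rm s}\mid X),$$ $$\Delta_{\rm c}(\pi)=I_\pi(X;Y_{\rm c}\mid U_{\rm c}),\qquad \Delta_{\rm s}(\pi)=I_\pi(P_{\rm phy};Y_{\rm s}\mid U_{\rm s},X).$$ Then $$\mathcal{I}_{\rm c}^{\rm phy}(\pi)=\mathcal{I}_{\rm c}^{\rm sem}(\pi)+\Delta_{\rm c}(\pi),\qquad \mathcal{I}_{\rm s}^{\rm phy}(\pi)=\mathcal{I}_{\rm s}^{\rm sem}(\pi)+\Delta_{\rm s}(\pi),$$ and consequently $\mathcal{I}_i^{\rm sem}(\pi)\le \mathcal{I}_i^{\rm phy}(\pi)$ for $i\in\{{\rm c},{\rm 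s}\}$.
   Context: Setting. A semantic context $\boldsymbol{\Omega}=(\mathcal{T}_{\rm c},\mathcal{T}_{\rm s},\mathcal{K}_{\rm c},\mathcal{K}_{\rm s})$ (communication and sensing task specifications and knowledge bases) is fixed and treated as a constant. $\Pi$ is a set of feasible policies; each $\pi\in\Pi$ determines the transmitted signal $X$ and hence a joint distribution of the following random variables: - $U_{\rm c}$, the communication task target, $U_{\rm c}=\phi_{\rm c}(S_{\rm c};\mathcal{T}_{\rm c},\mathcal{K}_{\rm c})$ for a source $S_{\rm c}$ and a deterministic map $\phi_{\rm c}$; - $X$, the shared transmitted signal; - $E$, the environmental state; $U_{\rm s}=\phi_{\rm s}(E;\mathcal{T}_{\rm s},\mathcal{K}_{\rm s})$, the sensing task target; and $P_{\rm phy}=\psi_{\rm phy}(E)$, the physical propagation parameters, with $\phi_{\rm s},\psi_{\rm phy}$ deterministic maps; - $Y_{\rm c}=\mathbf{H}_{\rm c}X+\mathbf{n}_{\rm c}$, the communication observation, with channel $\mathbf{H}_{\rm c}$ and noise $\mathbf{n}_{\rm c}$; - $Y_{\rm s}=\mathbf{H}_{\rm s}(P_{\rm phy})X+\mathbf{n}_{\rm s}$, the sensing observation, with noise $\mathbf{n}_{\rm s}$; this model satisfies $p_\pi(y_{\rm s}\mid e,p_{\rm phy},x)=p_\pi(y_{\rm s}\mid p_{\rm phy},x)$. $I_\pi(\cdot;\cdot)$ and $I_\pi(\cdot;\cdot\mid\cdot)$ denote the usual (conditional) mutual information, with values in $[0,\infty]$, under the distribution induced by $\pi$. The Markov chain $A\to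 B\to C$ means that $A$ and $C$ are conditionally independent given $B$. *)

(* Defs.v *)
From HB Require Import structures.
From mathcomp Require Import all_boot all_order all_algebra.
From mathcomp Require Import all_classical all_reals all_analysis.
From mathcomp Require Import measurable_realfun.
From mathcomp.real_closed Require Import complex.

Set Implicit Arguments.
Unset Strict Implicit.
Unset Printing Implicit Defensive.

Import Order.TTheory GRing.Theory Num.Theory.
Import numFieldNormedType.Exports.

Local Open Scope classical_set_scope.
Local Open Scope ring_scope.

Section complex_matrices.
Context (R : realType) (m n : nat).

Definition cmx := 'M[R[i]]_(m, n).

HB.instance Definition _ := GRing.Zmodule.on cmx.
HB.instance Definition _ := isPointed.Build cmx 0.

Definition cmx_re (i : 'I_m) (j : 'I_n) (A : cmx) : R :=
  complex.Re ((A : 'M[R[i]]_(m, n)) i j).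
Definition cmx_im (i : 'I_m) (j : 'I_n) (A : cmx) : R :=
  complex.Im ((A : 'M[R[i]]_(m, n)) i j).

(* These cylinders generate the Borel sigma-algebra of C^(m x n), identified
   with R^(2mn). *)
Definition cmx_cylinders : set (set cmx) :=
  [set C | exists i j (B : set R), measurable B /\
     (C = cmx_re i j @^-1` B \/ C = cmx_im i j @^-1` B)].

HB.instance Definition _ :=
  Measurable.copy cmx (g_sigma_algebraType cmx_cylinders).

Lemma measurable_cmx_re i j : measurable_fun setT (cmx_re i j).
Proof.
move=> _ B mB; rewrite setTI; apply: sub_sigma_algebra.
by exists i, j, B; split => //; left.
Qed.

Lemma measurable_cmx_im i j : measurable_fun setT (cmx_im i j).
Proof.
move=> _ B mB; rewrite setTI; apply: sub_sigma_algebra.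
by exists i, j, B; split => //; right.
Qed.

Lemma measurable_fun_cmx d (T : measurableType d) (f : T -> cmx) :
  (forall i j, measurable_fun setT (cmx_re i j \o f)) ->
  (forall i j, measurable_fun setT (cmx_im i j \o f)) ->
  measurable_fun setT f.
Proof.
move=> mre mim; apply: (@measurability _ _ _ _ _ _ cmx_cylinders) => //.
move=> _ [_ [i [j [B [mB [->|->]]]]] <-].
- exact: mre.
- exact: mim.
Qed.

End complex_matrices.

Section affine_observation.
Context d (T : measurableType d) (R : realType) (m n l : nat).
Variables (H : {mfun T >-> cmx R m n}) (X : {mfun T >-> cmx R n l})
  (N : {mfun T >-> cmx R m l}).

Definition observation (t : T) : cmx R m l :=
  ((H t : 'M[R[i]]_(m, n)) *m (X t : 'M[R[i]]_(n, l)) + N t)%R.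

Let ReM (a b : R[i]) : complex.Re (a * b) =
  complex.Re a * complex.Re b - complex.Im a * complex.Im b.
Proof. by case: a => ? ?; case: b. Qed.

Let ImM (a b : R[i]) : complex.Im (a * b) =
  complex.Re a * complex.Im b + complex.Im a * complex.Re b.
Proof. by case: a => ? ?; case: b. Qed.

Let ReD (a b : R[i]) : complex.Re (a + b) = complex.Re a + complex.Re b.
Proof. by case: a => ? ?; case: b. Qed.

Let ImD (a b : R[i]) : complex.Im (a + b) = complex.Im a + complex.Im b.
Proof. by case: a => ? ?; case: b. Qed.

Let measurable_observation : measurable_fun setT observation.
Proof.
have mr p q (F : {mfun T >-> cmx R p q}) i j :
    measurable_fun setT (fun t => cmx_re i j (F t)).
  by apply: measurableT_comp => //; exact: measurable_cmx_re.
have mi p q (F : {mfun T >-> cmx R p q}) i j :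
    measurable_fun setT (fun t => cmx_im i j (F t)).
  by apply: measurableT_comp => //; exact: measurable_cmx_im.
apply: measurable_fun_cmx => i j.
- rewrite (_ : _ \o _ = (fun t => \sum_k (cmx_re i k (H t) * cmx_re k j (X t) -
      cmx_im i k (H t) * cmx_im k j (X t)) + cmx_re i j (N t))); last first.
    apply/funext => t; rewrite /= /observation /cmx_re !mxE ReD; congr (_ + _).
    rewrite (big_morph (@complex.Re R) ReD erefl).
    by apply: eq_bigr => k _; rewrite ReM.
  apply: measurable_funD => //; apply: measurable_sum => k.
  by apply: measurable_funB; apply: measurable_funM.
- rewrite (_ : _ \o _ = (fun t => \sum_k (cmx_re i k (H t) * cmx_im k j (X t) +
      cmx_im i k (H t) * cmx_re k j (X t)) + cmx_im i j (N t))); last first.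
    apply/funext => t; rewrite /= /observation /cmx_im !mxE ImD; congr (_ + _).
    rewrite (big_morph (@complex.Im R) ImD erefl).
    by apply: eq_bigr => k _; rewrite ImM.
  apply: measurable_funD => //; apply: measurable_sum => k.
  by apply: measurable_funD; apply: measurable_funM.
Qed.

HB.instance Definition _ :=
  isMeasurableFun.Build _ _ _ _ observation measurable_observation.

End affine_observation.

Section paired_random_variable.
Context d d1 d2 (T : measurableType d) (T1 : measurableType d1)
  (T2 : measurableType d2).
Variables (A : {mfun T >-> T1}) (B : {mfun T >-> T2}).

Definition pairRV (t : T) : T1 * T2 := (A t, B t).

Let measurable_pairRV : measurable_fun setT pairRV.
Proof. exact: measurable_fun_pair. Qed.

HB.instance Definition _ :=
  isMeasurableFun.Build _ _ _ _ pairRV measurable_pairRV.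

End paired_random_variable.

Section information.
Local Open Scope ereal_scope.
Context (R : realType).

(* Kullback-Leibler divergence.  The negative part of the integrand is always
   mu-integrable, so the integral is a well-defined element of [0, +oo]. *)
Definition kl_div d (T : measurableType d) (mu nu : probability T R) : \bar R :=
  if `[< mu `<< nu >]
  then \int[mu]_x lne (Radon_Nikodym_SigmaFinite.f mu nu x)
  else +oo.

Context d (T : measurableType d) (P : probability T R).

Definition mutual_info d1 d2 (T1 : measurableType d1) (T2 : measurableType d2)
    (A : {RV P >-> T1}) (B : {RV P >-> T2}) : \bar R :=
  kl_div (distribution P (pairRV A B))
         (distribution P A \x distribution P B).

(* f is a version of b |-> P(D | B = b). *)
Definition cond_prob_version dB (TB : measurableType dB) (B : {RV P >-> TB})
    (D : set T) (f : TB -> R) : Prop :=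
  measurable_fun setT f /\
  forall b : set TB, measurable b ->
    \int[distribution P B]_(z in b) (f z)%:E = P (D `&` B @^-1` b).

(* For a measurable event D, versions exist by the Radon-Nikodym theorem and
   agree almost everywhere for the law of B; below, cond_prob occurs only inside
   integrals and almost-everywhere statements, which do not depend on the chosen
   version. *)
Definition cond_prob dB (TB : measurableType dB) (B : {RV P >-> TB})
    (D : set T) : TB -> R :=
  xget (cst 0%R) [set f | cond_prob_version B D f].

(* A and C are conditionally independent given B. *)
Definition markov_chain dA dB dC (TA : measurableType dA)
    (TB : measurableType dB) (TC : measurableType dC)
    (A : {RV P >-> TA}) (B : {RV P >-> TB}) (C : {RV P >-> TC}) : Prop :=
  forall (a : set TA) (c : set TC), measurable a -> measurable c ->
    {ae distribution P B, forall z,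
      cond_prob B (A @^-1` a `&` C @^-1` c) z =
      (cond_prob B (A @^-1` a) z * cond_prob B (C @^-1` c) z)%R}.

(* m is the measure P_B(dz) P_{A|B}(. | z) P_{C|B}(. | z) on TB * (TA * TC).
   This equation determines m, by the pi-lambda theorem. *)
Definition is_cond_product dA dB dC (TA : measurableType dA)
    (TB : measurableType dB) (TC : measurableType dC)
    (A : {RV P >-> TA}) (C : {RV P >-> TC}) (B : {RV P >-> TB})
    (m : probability (TB * (TA * TC))%type R) : Prop :=
  forall (b : set TB) (a : set TA) (c : set TC),
    measurable b -> measurable a -> measurable c ->
    m (b `*` (a `*` c)) =
    \int[distribution P B]_(z in b)
      (cond_prob B (A @^-1` a) z * cond_prob B (C @^-1` c) z)%:E.

(* I(A; C | B), the divergence of P_{BAC} from P_B P_{A|B} P_{C|B}.  The second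
   branch is a junk value: the conditional product exists as soon as A or C has
   a regular conditional distribution given B, hence whenever TA or TC is
   standard Borel, as cmx R m n is. *)
Definition cond_mutual_info dA dB dC (TA : measurableType dA)
    (TB : measurableType dB) (TC : measurableType dC)
    (A : {RV P >-> TA}) (C : {RV P >-> TC}) (B : {RV P >-> TB}) : \bar R :=
  match pselect (exists m, is_cond_product A C B m) with
  | left e => kl_div (distribution P (pairRV B (pairRV A C))) (sval (cid e))
  | right _ => +oo
  end.

End information.

Record semantic_context (TaskC TaskS KbC KbS : Type) := SemanticContext {
  comm_task : TaskC;
  sens_task : TaskS;
  comm_kb : KbC;
  sens_kb : KbS }.

(* X is an n x L matrix, observed with mc communication and ms sensing outputs;
   L = 1 is the vector case.  The channel and the noises are arbitrary random
   variables: no law or independence is prescribed.  All the exogenous randomness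
   lives on (T, P), and a policy acts only through the transmitted signal. *)
Record isac_model (R : realType) d (T : measurableType d) (P : probability T R)
    (n L mc ms : nat) (TaskC TaskS KbC KbS Policy : Type)
    dSc (SpSc : measurableType dSc) dUc (SpUc : measurableType dUc)
    dE (SpE : measurableType dE) dUs (SpUs : measurableType dUs)
    dPh (SpPh : measurableType dPh) := IsacModel {
  feasible : set Policy;
  source : {RV P >-> SpSc};
  phi_c : TaskC -> KbC -> {mfun SpSc >-> SpUc};
  env : {RV P >-> SpE};
  phi_s : TaskS -> KbS -> {mfun SpE >-> SpUs};
  psi_phy : {mfun SpE >-> SpPh};
  signal : Policy -> {RV P >-> cmx R n L};
  comm_channel : {RV P >-> cmx R mc n};
  comm_noise : {RV P >-> cmx R mc L};
  sens_channel : {mfun SpPh >-> cmx R ms n};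
  sens_noise : {RV P >-> cmx R ms L} }.

Section induced_random_variables.
Context (R : realType) d (T : measurableType d) (P : probability T R)
    (n L mc ms : nat) (TaskC TaskS KbC KbS Policy : Type)
    dSc (SpSc : measurableType dSc) dUc (SpUc : measurableType dUc)
    dE (SpE : measurableType dE) dUs (SpUs : measurableType dUs)
    dPh (SpPh : measurableType dPh).
Variables (M : isac_model P n L mc ms TaskC TaskS KbC KbS Policy
                 SpSc SpUc SpE SpUs SpPh)
  (Omega : semantic_context TaskC TaskS KbC KbS) (pi : Policy).

Definition comm_target : {RV P >-> SpUc} :=
  phi_c M (comm_task Omega) (comm_kb Omega) \o source M.

Definition sens_target : {RV P >-> SpUs} :=
  phi_s M (sens_task Omega) (sens_kb Omega) \o env M.

Definition phy_param : {RV P >-> SpPh} := psi_phy M \o env M.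

Definition comm_obs : {RV P >-> cmx R mc L} :=
  observation (comm_channel M) (signal M pi) (comm_noise M).

Definition sens_obs : {RV P >-> cmx R ms L} :=
  observation (sens_channel M \o phy_param) (signal M pi) (sens_noise M).

(* p(y_s | e, p_phy, x) = p(y_s | p_phy, x). *)
Definition sens_local : Prop :=
  forall c : set (cmx R ms L), measurable c ->
    {ae distribution P (pairRV (env M) (pairRV phy_param (signal M pi))),
      forall z,
      cond_prob (P := P) (pairRV (env M) (pairRV phy_param (signal M pi)))
        (sens_obs @^-1` c) z =
      cond_prob (P := P) (pairRV phy_param (signal M pi))
        (sens_obs @^-1` c) z.2}.

End induced_random_variables.

(* Main.v *)
(** The data-processing identity is the chain rule for the divergence.  Let V
    be the pair of the semantic target and the physical variable, Y the
    observation, and let M, N be the joint laws in which the conditional law of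
    Y given V is replaced by its conditional law given, respectively, the common
    conditioning variable and the semantic variables.  On the semantic
    marginals, law(V, Y) and N coincide, so dN/dM is the density g of the
    semantic marginal of law(V, Y), and d law(V, Y)/dM = g * d law(V, Y)/dN.  By
    the Markov property, d law(V, Y)/dM is a function of the physical variables
    and Y, so the left-hand divergence is not changed by forgetting the semantic
    target.

    The conditional laws exist since Y takes values in a space of complex
    matrices.  They are represented by independent noise, Y ~ q(B, noise) given
    B, so that only product measures and image measures are needed: a real Y is
    obtained from a uniform noise by the conditional quantile function, and a
    matrix coordinate by coordinate. *)

Require Import Defs.
From HB Require Import structures.
From mathcomp Require Import all_boot all_order all_algebra.
From mathcomp Require Import all_classical all_reals all_analysis.
From mathcomp Require Import measurable_realfun lra.
From mathcomp.real_closed Require Import complex.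

Set Implicit Arguments.
Unset Strict Implicit.
Unset Printing Implicit Defensive.

Import Order.TTheory GRing.Theory Num.Theory.
Import numFieldNormedType.Exports.

Local Open Scope classical_set_scope.
Local Open Scope ereal_scope.

(** * Densities and Kullback-Leibler divergence *)

(** Divergences may be infinite, so the logarithms of densities cannot be assumed integrable.
    Additivity rests on the pointwise bound f * max(- ln f, 0) <= 1: under the first measure the
    negative part of the logarithm has integral at most 1, and a sum of such logarithms splits even
    at +oo. Infinite values caused by a failure of absolute continuity are separate cases.

    The targets, the environment and the propagation parameters live in arbitrary measurable spaces
    and need not have regular conditional laws. Hence only the observation is ever disintegrated,
    always given the other variables. Both identities are then instances of a single statement: the
    common conditioning variable is trivial for communication and is the transmitted signal for
    sensing. *)

Section density.
Context (R : realType) d (T : measurableType d).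

(** Real-valued and nonnegative everywhere, so that [ln] applies and products of densities avoid 0 *
    oo. Plain set functions are allowed, so that every kind of measure fits. *)
Definition density (mu nu : set T -> \bar R) (f : T -> R) : Prop :=
  [/\ measurable_fun setT f, (forall x, 0 <= f x)%R &
      forall A, measurable A ->
        mu A = \int[nu]_(x in A) (f x)%:E].

Lemma dominates_density (mu : {finite_measure set T -> \bar R}%R)
    (nu : {sigma_finite_measure set T -> \bar R}%R) :
  mu `<< nu -> exists f, density mu nu f.
Proof.
move=> munu; exists (fine \o Radon_Nikodym_SigmaFinite.f mu nu).
have fE x : ((fine \o Radon_Nikodym_SigmaFinite.f mu nu) x)%:E =
    Radon_Nikodym_SigmaFinite.f mu nu x.
  by rewrite /= fineK//; exact: Radon_Nikodym_SigmaFinite.f_fin_num.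
split.
- apply/measurable_EFinP; rewrite (_ : _ \o _ = Radon_Nikodym_SigmaFinite.f mu nu).
    exact: measurable_int (Radon_Nikodym_SigmaFinite.f_integrable munu).
  by apply/funext => x; exact: fE.
- by move=> x; apply: fine_ge0; exact: Radon_Nikodym_SigmaFinite.f_ge0.
- move=> A mA; rewrite (Radon_Nikodym_SigmaFinite.f_integral munu mA).
  by apply: eq_integral => x _; rewrite fE.
Qed.

Lemma density_dominates (mu nu : {measure set T -> \bar R}%R) f :
  density mu nu f -> mu `<< nu.
Proof.
move=> [mf f0 muE]; apply/null_content_dominatesP => A mA nuA.
rewrite muE//; apply: null_set_integral => //.
exact/measurable_EFinP/measurable_funTS.
Qed.

Lemma density_ae_RN (mu : {finite_measure set T -> \bar R}%R)
    (nu : {sigma_finite_measure set T -> \bar R}%R) f :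
  density mu nu f ->
  ae_eq nu setT (Radon_Nikodym_SigmaFinite.f mu nu) (EFin \o f).
Proof.
move=> df; have munu := density_dominates df; case: df => mf f0 muE.
apply: integral_ae_eq => //.
- exact: Radon_Nikodym_SigmaFinite.f_integrable.
- exact/measurable_EFinP.
- move=> A _ mA; rewrite -muE//.
  by rewrite -Radon_Nikodym_SigmaFinite.f_integral.
Qed.

Lemma integral_density (mu : {finite_measure set T -> \bar R}%R)
    (nu : {sigma_finite_measure set T -> \bar R}%R) f (g : T -> \bar R) E :
  density mu nu f -> measurable E -> measurable_fun setT g ->
  (forall x, 0 <= g x) ->
  \int[mu]_(x in E) g x = \int[nu]_(x in E) (g x * (f x)%:E).
Proof.
move=> df mE mg g0; have munu := density_dominates df.
rewrite -(Radon_Nikodym_SigmaFinite.change_of_variables munu g0 mE); last first.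
  exact: measurable_funTS.
have [mf f0 _] := df.
have mRN : measurable_fun setT (Radon_Nikodym_SigmaFinite.f mu nu).
  exact: measurable_int (Radon_Nikodym_SigmaFinite.f_integrable munu).
apply: ge0_ae_eq_integral => //.
- by apply: measurable_funTS; exact: emeasurable_funM.
- apply: measurable_funTS; apply: emeasurable_funM => //.
  exact/measurable_EFinP.
- by move=> x _; rewrite mule_ge0// Radon_Nikodym_SigmaFinite.f_ge0.
- by move=> x _; rewrite mule_ge0// lee_fin.
- apply: filterS (density_ae_RN df) => x /(_ I) /= -> //.
Qed.

(** The zero set of [f] is null for [mu], though perhaps not for [nu]; therefore [ln f] is
    meaningful under [mu]. *)
Lemma density_ae_gt0 (mu : {finite_measure set T -> \bar R}%R)
    (nu : {sigma_finite_measure set T -> \bar R}%R) f :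
  density mu nu f -> {ae mu, forall x, (0 < f x)%R}.
Proof.
move=> [mf f0 muE]; exists (f @^-1` [set 0%R]); split.
- by rewrite -[X in measurable X]setTI; exact: mf.
- rewrite muE; last by rewrite -[X in measurable X]setTI; exact: mf.
  by apply: integral0_eq => x /= ->.
- by move=> x /= /negP; rewrite lt_neqAle f0 andbT negbK => /eqP.
Qed.

End density.

Section kl.
Context (R : realType) d (T : measurableType d).
Implicit Types mu nu : probability T R.

(** The values [lne 0 = -oo] and the real [ln 0] differ only where [f] vanishes, a [mu]-null set, so
    any real version of the density may be used. *)
Lemma kl_div_density mu nu f : density mu nu f ->
  kl_div mu nu = \int[mu]_x (ln (f x))%:E.
Proof.
move=> df; rewrite /kl_div asboolT; last exact: density_dominates df.
have munu := density_dominates df.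
have [mf f0 _] := df.
have mln : measurable_fun setT (fun x => (ln (f x))%:E).
  by apply/measurable_EFinP; apply: measurableT_comp => //; exact: measurable_ln.
have H : ae_eq mu setT (fun x => lne (Radon_Nikodym_SigmaFinite.f mu nu x))
    (fun x => (ln (f x))%:E).
  have := null_dominates_ae_eq measurableT munu (density_ae_RN df).
  apply: filterS2 (density_ae_gt0 df) => x fx /(_ I) /= -> _.
  by rewrite lne_EFin.
apply: ae_eq_integral => //.
have mRN : measurable_fun setT (Radon_Nikodym_SigmaFinite.f mu nu).
  exact: measurable_int (Radon_Nikodym_SigmaFinite.f_integrable munu).
(* The derivative is finite, so [lne] of it is a measurable case distinction on the sign. *)
rewrite (_ : (fun x => _) = (fun x =>
    if (fine (Radon_Nikodym_SigmaFinite.f mu nu x) <= 0)%R then -oo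
    else (ln (fine (Radon_Nikodym_SigmaFinite.f mu nu x)))%:E)).
  have mfRN : measurable_fun setT (fine \o Radon_Nikodym_SigmaFinite.f mu nu).
    exact: measurableT_comp.
  apply: measurable_fun_ifT => //.
  - by apply: measurable_fun_ler.
  - by apply/measurable_EFinP; apply: measurableT_comp => //; exact: measurable_ln.
apply/funext => x.
have := Radon_Nikodym_SigmaFinite.f_fin_num munu x.
by case: (Radon_Nikodym_SigmaFinite.f mu nu x).
Qed.

End kl.

(** * Nonnegativity of the divergence *)

Section kl_nonnegativity.
Context (R : realType).

Lemma ln_le_subr1 (x : R) : (0 < x)%R -> (ln x <= x - 1)%R.
Proof.
move=> x0; have := @le_ln1Dx R (x - 1)%R.
by rewrite [(1 + _)%R]addrC subrK; apply; rewrite ltrBDl subrr.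
Qed.

Lemma ln_ge_1subV (x : R) : (0 < x)%R -> (1 - x^-1 <= ln x)%R.
Proof.
move=> x0; have := @ln_le_subr1 x^-1; rewrite invr_gt0 lnV ?posrE// => /(_ x0).
lra.
Qed.

(** This is [1 - x^-1 <= ln x] multiplied by [x]; the factor [x] is the density that appears when an
    integral against [mu] becomes one against [nu]. *)
Lemma maxNln_le (x : R) : (0 <= x)%R ->
  (Num.max (- ln x) 0 * x <= Num.max (1 - x) 0)%R.
Proof.
rewrite le_eqVlt => /predU1P[<-|x0]; first by rewrite mulr0 le_max lexx orbT.
have [x1|x1] := leP x 1%R.
- have lnx : (- ln x <= x^-1 - 1)%R by have := ln_ge_1subV x0; lra.
  have x1' : (1 <= x^-1)%R by rewrite invf_ge1.
  rewrite !max_l ?subr_ge0//.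
  + apply: (@le_trans _ _ ((x^-1 - 1) * x)%R); first by rewrite ler_pM2r.
    by rewrite mulrBl mulVf ?gt_eqF// mul1r.
  + by rewrite oppr_ge0 ln_le0.
- by rewrite max_r ?mul0r ?le_max ?lexx ?orbT// oppr_le0 ln_ge0// ltW.
Qed.

Lemma maxln_ge (x : R) : (0 <= x)%R ->
  (Num.max (x - 1) 0 <= Num.max (ln x) 0 * x)%R.
Proof.
rewrite le_eqVlt => /predU1P[<-|x0].
  by rewrite mulr0 sub0r max_r// oppr_le0.
have [x1|x1] := leP x 1%R.
- by rewrite max_r ?subr_le0// mulr_ge0 ?(ltW x0)// le_max lexx orbT.
- rewrite !max_l ?subr_ge0 ?(ltW x1)//; last by rewrite ln_ge0// ltW.
  have lnx := ln_ge_1subV x0.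
  apply: (@le_trans _ _ ((1 - x^-1) * x)%R); last by rewrite ler_pM2r.
  by rewrite mulrBl mulVf ?gt_eqF// mul1r.
Qed.

Context d (T : measurableType d).
Implicit Types mu nu : probability T R.

Lemma funepos_EFin (f : T -> R) x :
  (fun x => (f x)%:E)^\+ x = (Num.max (f x) 0)%:E.
Proof. by rewrite funeposE EFin_max. Qed.

Lemma funeneg_EFin (f : T -> R) x :
  (fun x => (f x)%:E)^\- x = (Num.max (- f x) 0)%:E.
Proof. by rewrite funenegE EFin_max EFinN. Qed.

Lemma measurable_max0 (f : T -> R) : measurable_fun setT f ->
  measurable_fun setT (fun x => (Num.max (f x) 0)%:E).
Proof.
by move=> mf; apply/measurable_EFinP; apply: measurable_maxr.
Qed.

Lemma measurable_ln_comp (f : T -> R) : measurable_fun setT f ->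
  measurable_fun setT (fun x => ln (f x)).
Proof. by move=> mf; apply: measurableT_comp => //; exact: measurable_ln. Qed.

Lemma integral_EFinE (mu : {measure set T -> \bar R}%R) (f : T -> R) :
  \int[mu]_x (f x)%:E =
  \int[mu]_x (Num.max (f x) 0)%:E - \int[mu]_x (Num.max (- f x) 0)%:E.
Proof.
rewrite integralE; congr (_ - _); apply: eq_integral => x _.
  exact: funepos_EFin.
exact: funeneg_EFin.
Qed.

Lemma EFin_max0_ge0 (r : R) : 0 <= (Num.max r 0)%:E.
Proof. by rewrite lee_fin le_max lexx orbT. Qed.

(** Both sides are the total variation distance: [f - 1] has [nu]-integral 0, so its positive and
    negative parts have equal integrals. *)
Lemma integral_max_subr1 mu nu f : density mu nu f ->
  \int[nu]_x (Num.max (1 - f x) 0)%:E = \int[nu]_x (Num.max (f x - 1) 0)%:E.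
Proof.
move=> [mf f0 muE].
have f1 : \int[nu]_x (f x)%:E = 1 by rewrite -muE// probability_setT.
have m1 : measurable_fun setT (fun x => (Num.max (1 - f x) 0)%:E).
  by apply: measurable_max0; exact: measurable_funB.
have m2 : measurable_fun setT (fun x => (Num.max (f x - 1) 0)%:E).
  by apply: measurable_max0; exact: measurable_funB.
have mf' : measurable_fun setT (fun x => (f x)%:E) by exact/measurable_EFinP.
(* Both integrands equal max(f, 1); this form avoids subtraction of integrals. *)
have : \int[nu]_x ((Num.max (1 - f x) 0)%:E + (f x)%:E) =
       \int[nu]_x ((Num.max (f x - 1) 0)%:E + 1).
  apply: eq_integral => x _; rewrite -!EFinD; congr EFin.
  by have [fx|fx] := leP (f x) 1%R;
    [rewrite max_l 1?max_r|rewrite max_r 1?max_l]; lra.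
have f0' x : [set: T] x -> 0 <= (f x)%:E by rewrite lee_fin.
do 2 (rewrite ge0_integralD//; try by move=> x _; exact: EFin_max0_ge0).
rewrite f1 integral_cst//= mul1e probability_setT => H.
by rewrite -[LHS](@addeK _ 1)// H addeK.
Qed.

Lemma integral_lnN_le1 mu nu f : density mu nu f ->
  \int[mu]_x (Num.max (- ln (f x)) 0)%:E <= 1.
Proof.
move=> df; have [mf f0 muE] := df.
have mln := measurable_ln_comp mf.
rewrite (integral_density df) //; last 2 first.
- by apply: measurable_max0; exact: measurableT_comp.
- by move=> x; rewrite lee_fin le_max lexx orbT.
apply: (@le_trans _ _ (\int[nu]_x (cst 1 x))).
  apply: ge0_le_integral => //=.
  - by move=> x _; rewrite mule_ge0 ?lee_fin// le_max lexx orbT.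
  - apply: emeasurable_funM; last exact/measurable_EFinP.
    by apply: measurable_max0; exact: measurableT_comp.
  - move=> x _; rewrite -EFinM lee_fin (le_trans (maxNln_le (f0 x)))//.
    by rewrite ge_max ler01 andbT; have := f0 x; lra.
rewrite integral_cst// mul1e; exact: probability_le1.
Qed.

(** With [f] the density, the negative part of [ln f] integrates under [mu] to at most the
    [nu]-integral of max(1 - f, 0), which equals that of max(f - 1, 0), which is at most the
    [mu]-integral of the positive part. No convexity argument is involved. *)
Lemma kl_div_ge0 mu nu : 0 <= kl_div mu nu.
Proof.
have [munu|] := pselect (mu `<< nu); last first.
  by move=> munu; rewrite /kl_div asboolF.
have [f df] := dominates_density munu.
rewrite (kl_div_density df); have [mf f0 muE] := df.
have mln := measurable_ln_comp mf.
rewrite integral_EFinE.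
have H : \int[mu]_x (Num.max (- ln (f x)) 0)%:E <=
    \int[mu]_x (Num.max (ln (f x)) 0)%:E.
  have mN : measurable_fun setT (fun x => (Num.max (- ln (f x)) 0)%:E).
    by apply: measurable_max0; exact: measurableT_comp.
  have mP : measurable_fun setT (fun x => (Num.max (ln (f x)) 0)%:E).
    exact: measurable_max0.
  have mf' : measurable_fun setT (fun x => (f x)%:E) by exact/measurable_EFinP.
  have max0 := EFin_max0_ge0.
  have mM (g : T -> \bar R) : measurable_fun setT g ->
      measurable_fun setT (fun x => g x * (f x)%:E).
    by move=> mg; exact: emeasurable_funM.
  rewrite !(integral_density df)//.
  apply: (@le_trans _ _ (\int[nu]_x (Num.max (1 - f x) 0)%:E)).
    apply: ge0_le_integral => //=.
    - by move=> x _; apply: mule_ge0; rewrite ?lee_fin ?le_max ?lexx ?orbT.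
    - exact: mM.
    - by apply: measurable_max0; exact: measurable_funB.
    - by move=> x _; rewrite -EFinM lee_fin; exact: maxNln_le.
  rewrite (integral_max_subr1 df).
  apply: ge0_le_integral => //=.
  - by apply: measurable_max0; exact: measurable_funB.
  - exact: mM.
  - by move=> x _; rewrite -EFinM lee_fin; exact: maxln_ge.
rewrite sube_ge0//.
apply/orP; left; rewrite ge0_fin_numE.
  by apply: le_lt_trans (integral_lnN_le1 df) _; rewrite ltry.
by apply: integral_ge0 => x _; rewrite lee_fin le_max lexx orbT.
Qed.

End kl_nonnegativity.

(** * The chain rule for the divergence, infinite values included *)

Section kl_chain.
Context (R : realType).

Lemma ae_pushforward d d' (T : measurableType d) (T' : measurableType d')
    (mu : {measure set T -> \bar R}%R) (p : T -> T') (Q : T' -> Prop) :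
  measurable_fun setT p ->
  {ae pushforward mu p, forall x, Q x} -> {ae mu, forall x, Q (p x)}.
Proof.
move=> mp [N [mN N0 QN]]; exists (p @^-1` N); split => //.
- by rewrite -[X in measurable X]setTI; exact: mp.
- by move=> x /= Qx; apply: QN.
Qed.

(** Here [x], [a], [b] stand for integrals of positive parts, which may be +oo; only the subtracted
    negative parts are finite. *)
Lemma sub_sumE (x y a a' b b' : \bar R) :
  0 <= x -> 0 <= a -> 0 <= b ->
  y \is a fin_num -> a' \is a fin_num -> b' \is a fin_num ->
  x + (a' + b') = y + (a + b) -> x - y = (a - a') + (b - b').
Proof.
move=> x0 a0 b0; case: y a' b' => [y||] // [a'||] // [b'||] // _ _ _.
case: a a0 => [a||]// _; case: b b0 => [b||]// _; case: x x0 => [x||]// _.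
by rewrite -?EFinN -?EFinD => -[E]; congr EFin; lra.
Qed.

(** Finite negative parts exclude oo - oo. The proof integrates (a+b)^+ + (a^- + b^-) = (a+b)^- +
    (a^+ + b^+), all of whose terms are nonnegative. *)
Lemma integralD_neg d (T : measurableType d) (mu : {measure set T -> \bar R}%R)
    (a b : T -> R) :
  measurable_fun setT a -> measurable_fun setT b ->
  \int[mu]_x (Num.max (- a x) 0)%:E < +oo ->
  \int[mu]_x (Num.max (- b x) 0)%:E < +oo ->
  \int[mu]_x (a x + b x)%:E = \int[mu]_x (a x)%:E + \int[mu]_x (b x)%:E.
Proof.
move=> ma mb aN bN.
have mab : measurable_fun setT (fun x => a x + b x)%R by exact: measurable_funD.
have mN (f : T -> R) : measurable_fun setT f ->
    measurable_fun setT (fun x => (Num.max (- f x) 0)%:E).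
  by move=> mf; apply: measurable_max0; exact: measurableT_comp.
have max0 := @EFin_max0_ge0 R.
have I0 (f : T -> R) : 0 <= \int[mu]_x (Num.max (f x) 0)%:E.
  by apply: integral_ge0.
have abN : \int[mu]_x (Num.max (- (a x + b x)) 0)%:E < +oo.
  apply: (@le_lt_trans _ _ (\int[mu]_x ((Num.max (- a x) 0)%:E +
      (Num.max (- b x) 0)%:E))).
    apply: ge0_le_integral => //=; first exact: mN.
    - by apply: emeasurable_funD; exact: mN.
    - move=> x _; rewrite -EFinD lee_fin ge_max opprD.
      by rewrite lerD ?le_max ?lexx//= addr_ge0// le_max lexx orbT.
  by rewrite ge0_integralD//; [exact: lte_add_pinfty|exact: mN|exact: mN].
have : \int[mu]_x ((Num.max (a x + b x) 0)%:E +
      ((Num.max (- a x) 0)%:E + (Num.max (- b x) 0)%:E)) =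
    \int[mu]_x ((Num.max (- (a x + b x)) 0)%:E +
      ((Num.max (a x) 0)%:E + (Num.max (b x) 0)%:E)).
  apply: eq_integral => x _; rewrite -!EFinD; congr EFin.
  have maxB (r : R) : (Num.max r 0 - Num.max (- r) 0 = r)%R.
    by have [r0|r0] := leP r 0%R; [rewrite max_l|rewrite max_r]; lra.
  by have := maxB (a x); have := maxB (b x); have := maxB (a x + b x)%R; lra.
have mP := @measurable_max0 R _ T.
rewrite !ge0_integralD//; try (by move=> *; exact: adde_ge0);
  try (by do ?apply: emeasurable_funD; first [exact: mN|exact: mP]);
  try exact: mN; try exact: mP.
move=> E; rewrite (integral_EFinE mu a) (integral_EFinE mu b).
rewrite (integral_EFinE mu (fun x => a x + b x)%R).
have fin (f : T -> R) : \int[mu]_x (Num.max (f x) 0)%:E < +oo ->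
    \int[mu]_x (Num.max (f x) 0)%:E \is a fin_num by rewrite ge0_fin_numE.
by apply: sub_sumE; rewrite ?fin.
Qed.

(** Brings the divergence of the images back to the source space, together with the bound on the
    negative part that [integralD_neg] asks for. *)
Lemma kl_div_density_push d d' (T : measurableType d) (T' : measurableType d')
    (mu nu : probability T R) (p : {mfun T >-> T'}) g :
  density (distribution mu p) (distribution nu p) g ->
  kl_div (distribution mu p) (distribution nu p) = \int[mu]_x (ln (g (p x)))%:E /\
  \int[mu]_x (Num.max (- ln (g (p x))) 0)%:E < +oo.
Proof.
move=> dg; have [mg g0 _] := dg; have mln := measurable_ln_comp mg.
split.
- rewrite (kl_div_density dg) [LHS]integral_EFinE [RHS]integral_EFinE; congr (_ - _).
  + rewrite ge0_integral_distribution//.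
      exact: measurable_max0.
    by move=> x; exact: EFin_max0_ge0.
  + rewrite ge0_integral_distribution//.
      by apply: measurable_max0; exact: measurableT_comp.
    by move=> x; exact: EFin_max0_ge0.
- apply: le_lt_trans (ltry 1%R); apply: le_trans (integral_lnN_le1 dg).
  rewrite ge0_integral_distribution//.
    by apply: measurable_max0; exact: measurableT_comp.
  by move=> x; exact: EFin_max0_ge0.
Qed.

(* The density of [mu] with respect to [nu1] is the product of [g \o p] and of
   the density with respect to [nu2]; the negative parts of both logarithms are
   integrable, so the integral of the sum splits even when it is infinite. *)
Lemma kl_div_chain d d' (T : measurableType d) (T' : measurableType d')
    (mu nu1 nu2 : probability T R) (p : {mfun T >-> T'}) :
  (forall g, density (distribution mu p) (distribution nu1 p) g ->
     density nu2 nu1 (g \o p)) ->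
  kl_div mu nu1 = kl_div (distribution mu p) (distribution nu1 p) + kl_div mu nu2.
Proof.
move=> lift.
have dom_push : mu `<< nu1 -> distribution mu p `<< distribution nu1 p.
  move=> /null_content_dominatesP munu; apply/null_content_dominatesP => A mA nuA.
  by apply: munu => //; rewrite -[X in measurable X]setTI; exact: measurable_funP.
have kl_infty (nu : probability T R) : ~ (mu `<< nu) -> kl_div mu nu = +oo.
  by move=> munu; rewrite /kl_div asboolF.
(* Without domination of the images there is none between [mu] and [nu1], and both sides are +oo,
   the second divergence being nonnegative. *)
have [pp|pp] := pselect (distribution mu p `<< distribution nu1 p); last first.
  rewrite kl_infty; last by move=> /dom_push.
  rewrite /kl_div asboolF// addye// -/(kl_div _ _) gt_eqF//.
  by apply: lt_le_trans (kl_div_ge0 _ _); rewrite ltNy0.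
have [g dg] := dominates_density pp; have [mg g0 _] := dg.
have d21 := lift _ dg.
have [m2|m2] := pselect (mu `<< nu2); last first.
  rewrite (kl_infty nu2)// addey; last first.
    by rewrite gt_eqF//; apply: lt_le_trans (kl_div_ge0 _ _); rewrite ltNy0.
  rewrite kl_infty// => m1; apply: m2.
  have [f df] := dominates_density m1; have [mf f0 muE] := df.
  apply/null_content_dominatesP => A mA nu2A.
  have mgp : measurable_fun setT (g \o p) by exact: measurableT_comp.
  (* On a [nu2]-null set [g \o p] vanishes [nu1]-almost everywhere, hence [mu]-almost everywhere;
     but it is positive [mu]-almost everywhere, so the set is [mu]-null. *)
  have gp0 : ae_eq nu1 A (EFin \o (g \o p)) (cst 0).
    apply/ae_eq_integral_abs => //.
      by apply/measurable_EFinP; exact: measurable_funTS.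
    case: d21 => _ _ /(_ _ mA); rewrite (_ : nu2 A = 0)// => nu1A.
    by rewrite [RHS]nu1A; apply: eq_integral => x _; rewrite /= ger0_norm.
  have /negligibleS : {ae mu, forall x, ~ A x}.
    apply: filterS2 (null_dominates_ae_eq mA m1 gp0)
      (ae_pushforward (measurable_funP p) (density_ae_gt0 dg)) => x /= gx g0x Ax.
    by move: (gx Ax) g0x => [->]; rewrite ltxx.
  move=> /(_ A) H; apply: measure_negligible => //; apply: H.
  by move=> x Ax; apply.
have [h dh] := dominates_density m2; have [mh h0 muE] := dh.
have df : density mu nu1 (fun x => g (p x) * h x)%R.
  split.
  - by apply: measurable_funM => //; exact: measurableT_comp.
  - by move=> x; exact: mulr_ge0.
  - move=> A mA; rewrite muE// (integral_density d21)//.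
    + by apply: eq_integral => x _; rewrite -EFinM mulrC.
    + exact/measurable_EFinP.
rewrite (kl_div_density df).
have [-> gN] := kl_div_density_push dg.
rewrite (kl_div_density dh) -integralD_neg//.
- apply: ae_eq_integral => //.
  + apply/measurable_EFinP; apply: measurable_ln_comp.
    by apply: measurable_funM => //; exact: measurableT_comp.
  + apply/measurable_EFinP; apply: measurable_funD; apply: measurable_ln_comp => //.
    exact: measurableT_comp.
  + apply: filterS2 (ae_pushforward (measurable_funP p) (density_ae_gt0 dg))
      (density_ae_gt0 dh) => x /= gx hx _.
    by rewrite lnM.
- by apply: measurable_ln_comp; exact: measurableT_comp.
- exact: measurable_ln_comp.
- by apply: le_lt_trans (integral_lnN_le1 dh) _; rewrite ltry.
Qed.

End kl_chain.

(** * Laws of pairs with a noisy component *)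

Section measure_on_product.
Context (R : realType).

Lemma measure_rect_unique d1 d2 (T1 : measurableType d1) (T2 : measurableType d2)
    (m1 m2 : {measure set (T1 * T2) -> \bar R}%R) :
  m1 setT < +oo ->
  (forall A B, measurable A -> measurable B -> m1 (A `*` B) = m2 (A `*` B)) ->
  forall D, measurable D -> m1 D = m2 D.
Proof.
move=> m1oo m12 D mD.
pose C : set (set (T1 * T2)) := [set A `*` B | A in measurable & B in measurable].
apply: (measure_unique C (fun=> setT)) => //.
- exact: measurable_prod_measurableType.
- move=> _ _ [X1 mX1 [X2 mX2 <-]] [Y1 mY1 [Y2 mY2 <-]].
  rewrite -setXI; exists (X1 `&` Y1); first exact: measurableI.
  by exists (X2 `&` Y2) => //; exact: measurableI.
- by move=> _; exists setT => //; exists setT => //; rewrite setXTT.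
- by rewrite bigcup_const//; exists 0%N.
- by move=> _ [A mA [B mB <-]]; exact: m12.
Qed.

(* The vacuous [let _ := mb in] below, and its analogues later on, keep the
   measurability hypothesis among the arguments, so that the instance attached
   to the definition can be inferred. *)
Section slice.
Context d1 d2 (T1 : measurableType d1) (T2 : measurableType d2).
Variables (m : {measure set (T1 * T2) -> \bar R}%R) (b : set T1).
Hypothesis mb : measurable b.

Definition slice_measure (D : set T2) : \bar R :=
  let _ := mb in m (b `*` D).

Let slice0 : slice_measure set0 = 0.
Proof. by rewrite /slice_measure setX0 measure0. Qed.

Let slice_ge0 D : 0 <= slice_measure D.
Proof. exact: measure_ge0. Qed.

Let slice_sigma_additive : semi_sigma_additive slice_measure.
Proof.
move=> F mF tF mUF; rewrite /slice_measure setX_bigcupr.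
apply: (@measure_semi_sigma_additive _ _ _ m (fun i => b `*` F i)) => //.
- by move=> i; exact: measurableX.
- move=> i j _ _ [[x y] [[_ /= Fi] [_ /= Fj]]].
  by apply: tF => //; exists y.
- by rewrite -setX_bigcupr; exact: measurableX.
Qed.

HB.instance Definition _ := isMeasure.Build _ _ _ slice_measure
  slice0 slice_ge0 slice_sigma_additive.

End slice.

(** Uniqueness on rectangles is used twice: for the outer product, then for the slices over a fixed
    first side. *)
Lemma measure_rect3_unique d1 d2 d3 (T1 : measurableType d1)
    (T2 : measurableType d2) (T3 : measurableType d3)
    (m1 m2 : {measure set (T1 * (T2 * T3)) -> \bar R}%R) :
  m1 setT < +oo ->
  (forall a b c, measurable a -> measurable b -> measurable c ->
    m1 (a `*` (b `*` c)) = m2 (a `*` (b `*` c))) ->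
  forall D, measurable D -> m1 D = m2 D.
Proof.
move=> m1oo m12; apply: measure_rect_unique => // a D ma mD.
apply: (@measure_rect_unique _ _ _ _ (slice_measure m1 ma) (slice_measure m2 ma))
  => //.
- apply: le_lt_trans m1oo; rewrite /= /slice_measure.
  by apply: le_measure; rewrite ?inE//; exact: measurableX.
- by move=> b c mb mc; exact: m12.
Qed.

Section integral_measure.
Context d (T : measurableType d) (mu : {measure set T -> \bar R}%R).
Variable f : T -> \bar R.
Hypotheses (mf : measurable_fun setT f) (f0 : forall x, 0 <= f x).

(** Packaged as a measure so that identities of integrals can be checked on rectangles only. *)
Definition integral_measure (A : set T) : \bar R :=
  let _ := (mf, f0) in \int[mu]_(x in A) f x.

Let im0 : integral_measure set0 = 0.
Proof. by rewrite /integral_measure integral_set0. Qed.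

Let im_ge0 D : 0 <= integral_measure D.
Proof. exact: integral_ge0. Qed.

Let im_sigma_additive : semi_sigma_additive integral_measure.
Proof.
move=> F mF tF mUF; rewrite /integral_measure; apply: cvg_toP.
  apply: ereal_nondecreasing_is_cvgn => m n mn.
  by apply: lee_sum_nneg_natr => // k _ _; exact: integral_ge0.
by rewrite ge0_integral_bigcup//; exact: measurable_funTS.
Qed.

HB.instance Definition _ := isMeasure.Build _ _ _ integral_measure
  im0 im_ge0 im_sigma_additive.

End integral_measure.

End measure_on_product.

Section noise_kernel.
Context (R : realType) dO (Om : measurableType dO) (lam : probability Om R).
Context dS dY (TS : measurableType dS) (TY : measurableType dY).
Variable q : {mfun (TS * Om)%type >-> TY}.

Lemma measurable_noise_section s c : measurable c ->
  measurable [set om | c (q (s, om))].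
Proof.
move=> mc; rewrite -[X in measurable X]setTI.
have : measurable_fun setT (fun om => q (s, om)).
  by apply: measurableT_comp => //; exact: measurable_pair1.
exact.
Qed.

Lemma measurable_noise_integral (phi : TS * TY -> \bar R) c :
  measurable c -> measurable_fun setT phi -> (forall z, 0 <= phi z) ->
  measurable_fun setT
    (fun s => \int[lam]_(om in [set om | c (q (s, om))]) phi (s, q (s, om))).
Proof.
move=> mc mphi phi0.
pose psi (z : TS * Om) := (phi \_ (setT `*` c)) (z.1, q z).
have mpsi : measurable_fun setT psi.
  apply: measurableT_comp; last exact: measurable_fun_pair.
  apply/(measurable_restrictT _ _).1; first exact: measurableX.
  exact: measurable_funTS.
have := measurable_fun_fubini_tonelli_F (m2 := lam) psi mpsi.
rewrite (_ : (fun s => _) = fubini_F lam psi); first apply.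
  by move=> z; rewrite /psi patchE; case: ifP.
apply/funext => s; rewrite integral_mkcond; apply: eq_integral => om _.
rewrite /psi !patchE; congr (if _ then _ else _).
by apply/idP/idP; rewrite !inE //=; case.
Qed.

Lemma measurable_noise_prob c : measurable c ->
  measurable_fun setT (fun s => lam [set om | c (q (s, om))]).
Proof.
move=> mc; have := @measurable_noise_integral (cst 1) _ mc.
rewrite (_ : (fun s => _) = (fun s => lam [set om | c (q (s, om))])).
  by apply.
apply/funext => s; rewrite integral_cst ?mul1e//.
exact: measurable_noise_section.
Qed.

End noise_kernel.

Section noise.
Context (R : realType) d (T : measurableType d) dO (Om : measurableType dO).

Section noisy.
Context dS dY (TS : measurableType dS) (TY : measurableType dY).
Variables (S : {mfun T >-> TS}) (q : {mfun (TS * Om)%type >-> TY}).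

(* [Om] carries an independent noise: [noisy S q] is sampled from the kernel
   [s |-> law of q (s, .)] given [S]. *)
Definition noisy (x : T * Om) : TY := q (S x.1, x.2).

Let measurable_noisy : measurable_fun setT noisy.
Proof.
apply: measurableT_comp => //; apply: measurable_fun_pair => //.
exact: measurableT_comp.
Qed.

HB.instance Definition _ :=
  isMeasurableFun.Build _ _ _ _ noisy measurable_noisy.

End noisy.

Section noiseless.
Context dV (TV : measurableType dV).
Variables (V : {mfun T >-> TV}).

Definition noiseless (x : T * Om) : TV := V x.1.

Let measurable_noiseless : measurable_fun setT noiseless.
Proof. exact: measurableT_comp. Qed.

HB.instance Definition _ :=
  isMeasurableFun.Build _ _ _ _ noiseless measurable_noiseless.

End noiseless.

Context dV dS dY (TV : measurableType dV) (TS : measurableType dS)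
  (TY : measurableType dY).
Variables (P : probability T R) (lam : probability Om R).

(** The recorded variable [V] and the variable [S] read by the kernel are separate: with
    [S = p \o V] this is the law under which the second coordinate depends on [V] through [p \o V]
    alone. *)
Definition noisy_law (V : {mfun T >-> TV}) (S : {mfun T >-> TS})
    (q : {mfun (TS * Om)%type >-> TY}) : probability (TV * TY)%type R :=
  distribution (P \x lam) (pairRV (noiseless V) (noisy S q)).

Lemma integral_noisy_law V S q (phi : TV * TY -> \bar R) D :
  measurable D -> measurable_fun setT phi -> (forall z, 0 <= phi z) ->
  \int[noisy_law V S q]_(z in D) phi z =
  \int[P]_t \int[lam]_om (phi \_ D) (V t, q (S t, om)).
Proof.
move=> mD mphi phi0.
have mphiD : measurable_fun setT (phi \_ D).
  by apply/(measurable_restrictT _ _).1 => //; exact: measurable_funTS.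
have phiD0 z : 0 <= (phi \_ D) z by rewrite patchE; case: ifP.
rewrite integral_mkcond ge0_integral_distribution//.
rewrite (@fubini_tonelli1 _ _ _ _ _ P lam)//; first exact: measurableT_comp.
by move=> x; exact: phiD0.
Qed.

Lemma noisy_law_rect V S q a c : measurable a -> measurable c ->
  noisy_law V S q (a `*` c) =
  \int[P]_(t in V @^-1` a) lam [set om | c (q (S t, om))].
Proof.
move=> ma mc.
have := integral_indic (noisy_law V S q) measurableT (measurableX ma mc).
rewrite setIT => <-.
rewrite integral_noisy_law//; last first.
  by apply/measurable_EFinP; apply: measurable_indic; exact: measurableX.
rewrite [RHS]integral_mkcond; apply: eq_integral => t _.
rewrite [RHS]patchE; case: ifPn => [|]; rewrite ?inE ?notin_setE /= => Vt.
- have mct : measurable [set om | c (q (S t, om))].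
    exact: measurable_noise_section.
  have := integral_indic lam measurableT mct; rewrite setIT => <-.
  apply: eq_integral => om _; rewrite patchE mem_setT !indicE.
  congr (_%:R%:E); congr nat_of_bool.
  by apply/idP/idP; rewrite !inE //=; case.
- apply: integral0_eq => om _; rewrite patchE mem_setT indicE memNset//.
  by case.
Qed.

End noise.

Section density_lift.
Context (R : realType) d (T : measurableType d) (P : probability T R).

Lemma integral_noisy_law_rect dO (Om : measurableType dO) (lam : probability Om R)
    dV dS dY (TV : measurableType dV) (TS : measurableType dS)
    (TY : measurableType dY) (V : {mfun T >-> TV}) (S : {mfun T >-> TS})
    (q : {mfun (TS * Om)%type >-> TY}) (phi : TV * TY -> \bar R) a c :
  measurable a -> measurable c -> measurable_fun setT phi ->
  (forall z, 0 <= phi z) ->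
  \int[noisy_law P lam V S q]_(z in a `*` c) phi z =
  \int[P]_(t in V @^-1` a)
    \int[lam]_(om in [set om | c (q (S t, om))]) phi (V t, q (S t, om)).
Proof.
move=> ma mc mphi phi0; rewrite integral_noisy_law//; last exact: measurableX.
rewrite [RHS]integral_mkcond; apply: eq_integral => t _.
rewrite [RHS]patchE; case: ifPn => [|]; rewrite ?inE ?notin_setE /= => Vt.
- rewrite [RHS]integral_mkcond; apply: eq_integral => om _.
  rewrite !patchE; congr (if _ then _ else _).
  by apply/idP/idP; rewrite !inE //=; case.
- by apply: integral0_eq => om _; rewrite patchE memNset//; case.
Qed.

Context dV dS dY (TV : measurableType dV) (TS : measurableType dS)
  (TY : measurableType dY).

Definition map_fst (p : TV -> TS) (z : TV * TY) : TS * TY := (p z.1, z.2).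

Section map_fst_measurable.
Variable p : {mfun TV >-> TS}.

Let measurable_map_fst : measurable_fun setT (map_fst p).
Proof. by apply: measurable_fun_pair => //; exact: measurableT_comp. Qed.

HB.instance Definition _ :=
  isMeasurableFun.Build _ _ _ _ (map_fst p) measurable_map_fst.

End map_fst_measurable.

(* If the second coordinate depends on [V] only through [p \o V], under both
   laws, then so does the density: both conditional probabilities of [c] given
   [p \o V = s] have the same integrals, hence agree almost everywhere. *)
Lemma density_noisy_law_lift dO (Om : measurableType dO) (lam : probability Om R)
    dO' (Om' : measurableType dO') (lam' : probability Om' R)
    (V : {mfun T >-> TV}) (p : {mfun TV >-> TS})
    (q : {mfun (TS * Om)%type >-> TY}) (q' : {mfun (TS * Om')%type >-> TY}) f :
  density (noisy_law P lam' (p \o V) (p \o V) q')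
    (noisy_law P lam (p \o V) (p \o V) q) f ->
  density (noisy_law P lam' V (p \o V) q') (noisy_law P lam V (p \o V) q)
    (f \o map_fst p).
Proof.
move=> [mf f0 fE].
have mG : measurable_fun setT (EFin \o (f \o map_fst p)).
  by apply/measurable_EFinP; exact: measurableT_comp.
have G0 z : 0 <= (EFin \o (f \o map_fst p)) z by rewrite lee_fin; exact: f0.
have mg : measurable_fun setT (EFin \o f) by exact/measurable_EFinP.
have g0 z : 0 <= (EFin \o f) z by rewrite lee_fin; exact: f0.
split => //; first exact: measurableT_comp.
move=> D mD.
apply: (measure_rect_unique (m2 := integral_measure (noisy_law P lam V (p \o V) q)
  mG G0)) mD.
  by rewrite (le_lt_trans (probability_le1 _ measurableT))// ltry.
move=> a c ma mc; apply: etrans (noisy_law_rect _ _ _ _ _ ma mc) _.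
apply/esym; apply: etrans (integral_noisy_law_rect _ _ _ _ ma mc mG G0) _.
apply/esym.
pose k s := lam' [set om | c (q' (s, om))].
pose F s := \int[lam]_(om in [set om | c (q (s, om))]) (EFin \o f) (s, q (s, om)).
have mk : measurable_fun setT k by exact: measurable_noise_prob.
have mF : measurable_fun setT F by exact: measurable_noise_integral.
have k0 s : 0 <= k s by exact: measure_ge0.
have F0 s : 0 <= F s by exact: integral_ge0.
set S : {mfun T >-> TS} := p \o V.
have kF : ae_eq (distribution P S) setT k F.
  apply: integral_ae_eq => //.
  - apply/integrableP; split => //.
    apply: (@le_lt_trans _ _ (\int[distribution P S]_x cst 1 x)); last first.
      rewrite integral_cst// mul1e.
      by rewrite (le_lt_trans (probability_le1 _ measurableT))// ltry.
    apply: ge0_le_integral => //=; first exact: measurableT_comp.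
    move=> s _; rewrite gee0_abs//; apply: probability_le1.
    exact: measurable_noise_section.
  - move=> b _ mb; rewrite !ge0_integral_pushforward//; [|exact: measurable_funTS
      |exact: measurable_funTS].
    have := fE _ (measurableX mb mc).
    by rewrite noisy_law_rect// integral_noisy_law_rect.
have {}kF := ae_pushforward (measurable_funP S) kF.
apply: ge0_ae_eq_integral => //.
- by rewrite -[X in measurable X]setTI; exact: measurable_funP.
- by apply: measurable_funTS; apply: (measurableT_comp mk); exact: measurable_funP.
- by apply: measurable_funTS; apply: (measurableT_comp mF); exact: measurable_funP.
- by move=> t _; exact: F0.
- by apply: filterS kF => t kFt _; exact: kFt.
Qed.

End density_lift.

(** * Divergence under sufficient and invertible maps *)

Section kl_div_invariance.
Context (R : realType).

Lemma density_eq_measure d (T : measurableType d)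
    (mu mu' nu nu' : {measure set T -> \bar R}%R) f :
  (forall D, measurable D -> mu D = mu' D) ->
  (forall D, measurable D -> nu D = nu' D) ->
  density mu nu f -> density mu' nu' f.
Proof.
move=> mumu' nunu' [mf f0 fE]; split => // A mA.
rewrite -mumu'// fE//; apply: eq_measure_integral => B mB _.
exact: nunu'.
Qed.

Lemma kl_div_eq_measure d (T : measurableType d) (mu mu' nu nu' : probability T R) :
  (forall D, measurable D -> mu D = mu' D) ->
  (forall D, measurable D -> nu D = nu' D) ->
  kl_div mu nu = kl_div mu' nu'.
Proof.
move=> mumu' nunu'.
have [munu|munu] := pselect (mu `<< nu).
- have [f df] := dominates_density munu.
  rewrite (kl_div_density df) (kl_div_density (density_eq_measure mumu' nunu' df)).
  by apply: eq_measure_integral => B mB _; exact: mumu'.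
- rewrite /kl_div asboolF// asboolF// => munu'; apply: munu.
  have [f df] := dominates_density munu'.
  apply: (@density_dominates _ _ _ _ _ f).
  by apply: density_eq_measure df => D mD; apply/esym; [exact: mumu'|exact: nunu'].
Qed.

Lemma kl_div_refl d (T : measurableType d) (mu : probability T R) :
  kl_div mu mu = 0.
Proof.
have d1 : density mu mu (cst 1%R).
  split => // A mA.
  by rewrite (eq_integral (cst 1))// integral_cst// mul1e.
rewrite (kl_div_density d1); apply: integral0_eq => x _ /=.
by rewrite ln1.
Qed.

(** If the density factors through [p], then [p] is a sufficient statistic: the chain rule applies
    with [nu2 = mu], whose remainder is 0. *)
Lemma kl_div_sufficient d d' (T : measurableType d) (T' : measurableType d')
    (mu nu : probability T R) (p : {mfun T >-> T'}) :
  (forall g, density (distribution mu p) (distribution nu p) g ->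
     density mu nu (g \o p)) ->
  kl_div (distribution mu p) (distribution nu p) = kl_div mu nu.
Proof.
by move=> lift; rewrite (kl_div_chain lift) kl_div_refl adde0.
Qed.

Lemma kl_div_cancel d d' (T : measurableType d) (T' : measurableType d')
    (mu nu : probability T R) (p : {mfun T >-> T'}) (s : T' -> T) :
  measurable_fun setT s -> cancel p s ->
  kl_div (distribution mu p) (distribution nu p) = kl_div mu nu.
Proof.
move=> ms ps; apply: kl_div_sufficient => g [mg g0 gE].
split; [exact: measurableT_comp|by move=> x; exact: g0|move=> A mA].
have msA : measurable (s @^-1` A).
  by rewrite -[X in measurable X]setTI; exact: ms.
have pA : p @^-1` (s @^-1` A) = A.
  by apply/seteqP; split => x /=; rewrite ps.
rewrite -[in LHS]pA; apply: etrans (gE _ msA) _.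
rewrite ge0_integral_pushforward//.
- by rewrite pA.
- by apply: measurable_funTS; exact/measurable_EFinP.
- by move=> x _; rewrite lee_fin.
Qed.

End kl_div_invariance.

Section chain_rule.
Context (R : realType) d (T : measurableType d) (P : probability T R).
Context dV dS dU dY (TV : measurableType dV) (TS : measurableType dS)
  (TU : measurableType dU) (TY : measurableType dY).
Variables (V : {mfun T >-> TV}) (Y : {mfun T >-> TY}).
Variables (p : {mfun TV >-> TS}) (u : {mfun TV >-> TU}).
Context dO (Om : measurableType dO) (lam : probability Om R).
Variables (qS : {mfun (TS * Om)%type >-> TY}) (qU : {mfun (TU * Om)%type >-> TY}).
Context dO1 (Om1 : measurableType dO1) (lam1 : probability Om1 R).
Variable q1 : {mfun (TS * Om1)%type >-> TY}.
Context dO2 (Om2 : measurableType dO2) (lam2 : probability Om2 R).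
Variable q2 : {mfun (TU * Om2)%type >-> TY}.

(** [qS] and [qU] describe one reference kernel, read off [p v] or off [u v]. The second hypothesis
    is the Markov property: given [V], the observation is generated from [p \o V] alone. The third
    says that [q2] is its conditional law given [u \o V]. *)
Lemma kl_div_noisy_chain :
  (forall v om, qS (p v, om) = qU (u v, om)) ->
  (forall D, measurable D ->
    distribution P (pairRV V Y) D = noisy_law P lam1 V (p \o V) q1 D) ->
  (forall D, measurable D ->
    distribution P (pairRV (u \o V) Y) D =
    noisy_law P lam2 (u \o V) (u \o V) q2 D) ->
  kl_div (distribution P (pairRV (p \o V) Y))
    (noisy_law P lam (p \o V) (p \o V) qS) =
  kl_div (distribution P (pairRV (u \o V) Y))
    (noisy_law P lam (u \o V) (u \o V) qU) +
  kl_div (distribution P (pairRV V Y)) (noisy_law P lam2 V (u \o V) q2).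
Proof.
move=> qSU VY UY.
pose Q := distribution P (pairRV V Y).
pose M := noisy_law P lam V (p \o V) qS.
(* The reference law needs both descriptions: densities are lifted along [p] with the first and
   along [u] with the second. *)
have ME D : measurable D -> M D = noisy_law P lam V (u \o V) qU D.
  move=> _.
  have E : pairRV (noiseless V) (noisy (p \o V) qS) =
      pairRV (noiseless V) (noisy (u \o V) qU) :> (_ -> _).
    by apply/funext => -[t om]; congr pair; exact: qSU.
  by rewrite /M /noisy_law /distribution /pushforward /= E.
have mX (d' : measure_display) (T' : measurableType d') (r : {mfun (TV * TY)%type >-> T'})
    A : measurable A -> measurable (r @^-1` A).
  by move=> mA; rewrite -[X in measurable X]setTI; exact: measurable_funP.
transitivity (kl_div Q M).
  transitivity (kl_div (distribution Q (map_fst p)) (distribution M (map_fst p))).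
    exact: kl_div_eq_measure.
  apply: kl_div_sufficient => g dg.
  apply: (density_eq_measure (fun D mD => esym (VY D mD))) => //.
  apply: density_noisy_law_lift.
  by apply: density_eq_measure dg => // D mD; apply: VY; exact: mX.
have <- : kl_div (distribution Q (map_fst u)) (distribution M (map_fst u)) =
    kl_div (distribution P (pairRV (u \o V) Y))
      (noisy_law P lam (u \o V) (u \o V) qU).
  apply: kl_div_eq_measure => D mD; first exact: erefl.
  exact: (ME _ (mX _ _ (map_fst u) _ mD)).
apply: kl_div_chain.
move=> g dg.
apply: (density_eq_measure (fun _ _ => erefl) (fun D mD => esym (ME D mD))).
apply: density_noisy_law_lift.
apply: density_eq_measure dg => D mD; first exact: UY.
by apply: ME; exact: mX.
Qed.

End chain_rule.

(** * Conditional probabilities *)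

Section event_measure.
Context (R : realType) d (T : measurableType d) (P : probability T R).
Context dB (TB : measurableType dB) (B : {mfun T >-> TB}) (D : set T).
Hypothesis mD : measurable D.

Lemma measurable_RV_preimage b : measurable b -> measurable (B @^-1` b).
Proof.
by move=> mb; rewrite -[X in measurable X]setTI; exact: measurable_funP.
Qed.

(** Its densities with respect to the law of [B] are the nonnegative versions of P(D | B = .). *)
Definition event_measure (b : set TB) : \bar R :=
  let _ := mD in P (D `&` B @^-1` b).

Let event0 : event_measure set0 = 0.
Proof. by rewrite /event_measure preimage_set0 setI0 measure0. Qed.

Let event_ge0 b : 0 <= event_measure b.
Proof. exact: measure_ge0. Qed.

Let event_sigma_additive : semi_sigma_additive event_measure.
Proof.
move=> F mF tF mUF; rewrite /event_measure preimage_bigcup setI_bigcupr.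
apply: (@measure_semi_sigma_additive _ _ _ P (fun i => D `&` B @^-1` F i)) => //.
- by move=> i; apply: measurableI => //; exact: measurable_RV_preimage.
- move=> i j _ _ [t [[_ /= Fi] [_ /= Fj]]].
  by apply: tF => //; exists (B t).
- apply: bigcup_measurable => i _; apply: measurableI => //.
  exact: measurable_RV_preimage.
Qed.

HB.instance Definition _ := isMeasure.Build _ _ _ event_measure
  event0 event_ge0 event_sigma_additive.

Let event_finite : fin_num_fun event_measure.
Proof.
move=> b mb; apply: fin_num_measure; apply: measurableI => //.
exact: measurable_RV_preimage.
Qed.

HB.instance Definition _ := @Measure_isFinite.Build _ _ _ event_measure event_finite.

Lemma integral_event_measure (phi : TB -> \bar R) b :
  measurable b -> measurable_fun setT phi -> (forall z, 0 <= phi z) ->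
  \int[event_measure]_(z in b) phi z = \int[P]_(t in D `&` B @^-1` b) phi (B t).
Proof.
move=> mb mphi phi0.
pose mu := mrestr P mD.
have dmu : density mu P (\1_D : T -> R)%R.
  split => //.
  by move=> A mA; rewrite integral_indic// /mu /mrestr setIC.
transitivity (\int[pushforward mu B]_(z in b) phi z).
  by apply: eq_measure_integral => A mA _; rewrite /= /pushforward /mu /mrestr setIC.
rewrite ge0_integral_pushforward//; [|exact: measurable_funTS].
have mBb := measurable_RV_preimage mb.
have Doo : P D < +oo by rewrite (le_lt_trans (probability_le1 _ mD))// ltry.
(* The same restriction of [P], now carrying the finite-measure structure that [integral_density]
   expects. *)
transitivity (\int[mfrestr mD Doo]_(t in B @^-1` b) (phi (B t))).
  by apply: eq_measure_integral.
rewrite (integral_density (nu := P) (f := (\1_D)%R))//; last first.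
  exact: measurableT_comp.
rewrite integral_mkcond [RHS]integral_mkcond; apply: eq_integral => t _.
rewrite !patchE indicE in_setI; case: ifPn => tb; last by rewrite andbF.
by rewrite andbT; case: ifPn => _; rewrite ?mule1 ?mule0.
Qed.

Lemma event_measure_dominates : event_measure `<< distribution P B.
Proof.
apply/null_content_dominatesP => b mb Pb; apply/eqP.
rewrite eq_le measure_ge0 andbT -[leRHS]Pb; apply: le_measure => //.
- by rewrite inE; apply: measurableI => //; exact: measurable_RV_preimage.
- by rewrite inE; exact: measurable_RV_preimage.
Qed.

Lemma density_cond_prob_version f :
  density event_measure (distribution P B) f -> cond_prob_version (P := P) B D f.
Proof. by move=> [mf f0 fE]; split => // b mb; rewrite -fE. Qed.

(** By Radon-Nikodym a version exists, so the choice made in [cond_prob] does not fall back on its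
    default. *)
Lemma cond_probP : cond_prob_version (P := P) B D (cond_prob (P := P) B D).
Proof.
have [f df] := dominates_density event_measure_dominates.
rewrite /cond_prob; apply: (@xgetPex _ _ [set f | cond_prob_version (P := P) B D f]).
by exists f; exact: density_cond_prob_version.
Qed.

Lemma density_ae_cond_prob f : density event_measure (distribution P B) f ->
  {ae distribution P B, forall z, cond_prob (P := P) B D z = f z}.
Proof.
move=> [mf f0 fE]; have [mc cE] := cond_probP.
have : ae_eq (distribution P B) setT (EFin \o f) (EFin \o cond_prob (P := P) B D).
  apply: integral_ae_eq => //.
  - apply/integrableP; split; first exact/measurable_EFinP.
    rewrite (eq_integral (EFin \o f)); last first.
      by move=> z _ /=; rewrite ger0_norm.
    by rewrite -fE// ltey_eq fin_num_measure.
  - exact/measurable_EFinP.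
  - by move=> b _ mb; rewrite -fE// cE.
by apply: filterS => z /(_ I) [].
Qed.

End event_measure.

Section outsourcing.
Context (R : realType) d (T : measurableType d) (P : probability T R).
Context dB dC (TB : measurableType dB) (TC : measurableType dC).
Context dO (Om : measurableType dO) (lam : probability Om R).
Variables (B : {mfun T >-> TB}) (C : {mfun T >-> TC}).
Variable q : {mfun (TB * Om)%type >-> TC}.

(* [C], given [B], is generated by an independent noise: a substitute for a
   regular conditional distribution. *)
Definition outsources : Prop := forall D, measurable D ->
  distribution P (pairRV B C) D = noisy_law P lam B B q D.

Hypothesis BCq : outsources.

Definition noise_prob c z : R := fine (lam [set om | c (q (z, om))]).

Lemma noise_probE c z : measurable c ->
  (noise_prob c z)%:E = lam [set om | c (q (z, om))].
Proof.
by move=> mc; rewrite fineK// fin_num_measure//; exact: measurable_noise_section.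
Qed.

Lemma measurable_noise_probR c : measurable c -> measurable_fun setT (noise_prob c).
Proof.
by move=> mc; apply: measurableT_comp => //; exact: measurable_noise_prob.
Qed.

Lemma noise_prob_ge0 c z : (0 <= noise_prob c z)%R.
Proof. by apply: fine_ge0; exact: measure_ge0. Qed.

Lemma density_noise_prob c (mc : measurable c) :
  density (event_measure P B (measurable_RV_preimage C mc)) (distribution P B)
    (noise_prob c).
Proof.
split; [exact: measurable_noise_probR|exact: noise_prob_ge0|move=> b mb].
rewrite ge0_integral_pushforward//.
- have := BCq (measurableX mb mc); rewrite noisy_law_rect// => E.
  transitivity (distribution P (pairRV B C) (b `*` c)).
    rewrite /= /event_measure /distribution /pushforward setIC.
    exact: erefl.
  by rewrite E; apply: eq_integral => t _; rewrite /= noise_probE.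
- by apply/measurable_EFinP/measurable_funTS; exact: measurable_noise_probR.
- by move=> z _; rewrite lee_fin noise_prob_ge0.
Qed.

Lemma ae_cond_prob_noise c : measurable c ->
  {ae distribution P B, forall z, cond_prob (P := P) B (C @^-1` c) z = noise_prob c z}.
Proof. by move=> mc; exact: density_ae_cond_prob (density_noise_prob mc). Qed.

(** The factor P(D | B) is a density, so it is absorbed into [event_measure]; the other factor
    becomes the noise kernel, defined at every point. *)
Lemma integral_cond_prob_mul D b c : measurable D -> measurable b -> measurable c ->
  \int[distribution P B]_(z in b)
    (cond_prob (P := P) B D z * cond_prob (P := P) B (C @^-1` c) z)%:E =
  \int[P]_(t in D `&` B @^-1` b) lam [set om | c (q (B t, om))].
Proof.
move=> mD mb mc.
have [f df] := dominates_density (event_measure_dominates (P := P) (B := B) mD).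
have [mf f0 fE] := df.
have [mcD _] := cond_probP P B mD.
have [mcC _] := cond_probP P B (measurable_RV_preimage C mc).
transitivity (\int[distribution P B]_(z in b) ((noise_prob c z)%:E * (f z)%:E)).
  apply: ae_eq_integral => //.
  - by apply/measurable_EFinP/measurable_funTS; exact: measurable_funM.
  - apply: measurable_funTS; apply: emeasurable_funM; apply/measurable_EFinP => //.
    exact: measurable_noise_probR.
  - apply: filterS2 (density_ae_cond_prob df) (ae_cond_prob_noise mc) => z.
    by move=> -> -> _; rewrite -EFinM mulrC.
rewrite -(integral_density df)//.
- rewrite integral_event_measure//.
  + by apply: eq_integral => t _; rewrite noise_probE.
  + by apply/measurable_EFinP; exact: measurable_noise_probR.
  + by move=> z; rewrite lee_fin noise_prob_ge0.
- by apply/measurable_EFinP; exact: measurable_noise_probR.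
- by move=> z; rewrite lee_fin noise_prob_ge0.
Qed.

End outsourcing.

Section conditional_information.
Context (R : realType) d (T : measurableType d) (P : probability T R).
Context dA dB dC (TA : measurableType dA) (TB : measurableType dB)
  (TC : measurableType dC).
Context dO (Om : measurableType dO) (lam : probability Om R).
Variables (A : {mfun T >-> TA}) (B : {mfun T >-> TB}) (C : {mfun T >-> TC}).
Variable q : {mfun (TB * Om)%type >-> TC}.
Hypothesis BCq : outsources P lam B C q.

(** The third coordinate is resampled from [B] with fresh noise, which makes it conditionally
    independent of [A]. *)
Let m : probability (TB * (TA * TC))%type R :=
  distribution (P \x lam) (pairRV (noiseless B) (pairRV (noiseless A) (noisy B q))).

Lemma noisy_is_cond_product : is_cond_product (P := P) A C B m.
Proof.
move=> b a c mb ma mc.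
rewrite (integral_cond_prob_mul BCq (measurable_RV_preimage A ma) mb mc).
rewrite -(noisy_law_rect P lam (pairRV A B) B q (measurableX ma mb) mc).
have E : pairRV (noiseless B) (pairRV (noiseless A) (noisy B q)) @^-1` (b `*` (a `*` c)) =
    pairRV (noiseless (pairRV A B)) (noisy B q) @^-1` ((a `*` b) `*` c).
  by apply/seteqP; split => -[t om] /=; [case=> ? []|case=> -[]].
by rewrite /m /noisy_law /distribution /pushforward /= E.
Qed.

(** The resampled law rules out the junk branch, and uniqueness on triple rectangles identifies it
    with the chosen conditional product. *)
Lemma cond_mutual_info_noisy :
  cond_mutual_info (P := P) A C B =
  kl_div (distribution P (pairRV B (pairRV A C))) m.
Proof.
rewrite /cond_mutual_info; case: pselect => [e|]; last first.
  by case; exists m; exact: noisy_is_cond_product.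
apply: kl_div_eq_measure => D mD; first exact: erefl.
apply/esym; apply: measure_rect3_unique mD => [|b a c mb ma mc].
  by rewrite (le_lt_trans (probability_le1 _ measurableT))// ltry.
have H := svalP (cid e).
exact: etrans (noisy_is_cond_product mb ma mc) (esym (H _ _ _ mb ma mc)).
Qed.

End conditional_information.

(** * Existence of noise representations *)

Section outsourceable.
Context (R : realType) d (T : measurableType d) (P : probability T R).

(** The noise space is existential because composing two samplers multiplies their noise spaces. *)
Definition outsourceable dB dC (TB : measurableType dB) (TC : measurableType dC)
    (B : {mfun T >-> TB}) (C : {mfun T >-> TC}) : Prop :=
  exists dO (Om : measurableType dO) (lam : probability Om R)
    (q : {mfun (TB * Om)%type >-> TC}), outsources P lam B C q.

Lemma outsources_rect dB dC (TB : measurableType dB) (TC : measurableType dC)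
    dO (Om : measurableType dO) (lam : probability Om R)
    (B : {mfun T >-> TB}) (C : {mfun T >-> TC}) (q : {mfun (TB * Om)%type >-> TC}) :
  (forall b c, measurable b -> measurable c ->
    P (B @^-1` b `&` C @^-1` c) =
    \int[P]_(t in B @^-1` b) lam [set om | c (q (B t, om))]) ->
  outsources P lam B C q.
Proof.
move=> H D mD; apply: measure_rect_unique mD => [|b c mb mc].
  by rewrite (le_lt_trans (probability_le1 _ measurableT))// ltry.
exact: etrans (H _ _ mb mc) (esym (noisy_law_rect _ _ _ _ _ mb mc)).
Qed.

Section closure.
Context dB (TB : measurableType dB) (B : {mfun T >-> TB}).

Lemma outsourceable_comp dC dZ (TC : measurableType dC) (TZ : measurableType dZ)
    (C : {mfun T >-> TC}) (h : {mfun TC >-> TZ}) (Z : {mfun T >-> TZ}) :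
  outsourceable B C -> Z =1 h \o C -> outsourceable B Z.
Proof.
move=> [dO [Om [lam [q BCq]]]] Zh; exists dO, Om, lam, (h \o q).
apply: outsources_rect => b c mb mc.
have mhc : measurable (h @^-1` c) by exact: measurable_RV_preimage.
have := BCq _ (measurableX mb mhc); rewrite noisy_law_rect// => <-.
rewrite /distribution /pushforward /=; congr (P _).
by apply/seteqP; split => t /=; rewrite Zh.
Qed.

Lemma outsourceable_cst dC (TC : measurableType dC) (c0 : TC) (C : {mfun T >-> TC}) :
  C =1 cst c0 -> outsourceable B C.
Proof.
(* Any probability space can carry the noise of a constant; [(T, P)] is at hand. *)
move=> Cc0; exists d, T, P, (cst c0); apply: outsources_rect => b c mb mc.
have mBb : measurable (B @^-1` b) by exact: measurable_RV_preimage.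
have [cc0|cc0] := pselect (c c0).
- rewrite (eq_integral (cst 1)); last first.
    move=> t _; rewrite (_ : [set _ | _] = setT) ?probability_setT//.
    by apply/seteqP; split.
  rewrite integral_cst// mul1e; congr (P _).
  by apply/seteqP; split => [t []//|t tb]; split => //=; rewrite Cc0.
- rewrite integral0_eq; last first.
    move=> t _; rewrite (_ : [set _ | _] = set0) ?measure0//.
    by apply/seteqP; split.
  rewrite (_ : _ `&` _ = set0) ?measure0//.
  by apply/seteqP; split => // t [_ /=]; rewrite Cc0.
Qed.

Section step.
Context dY dy dZ (TY : measurableType dY) (Ty : measurableType dy)
  (TZ : measurableType dZ).
Variables (Y : {mfun T >-> TY}) (y : {mfun T >-> Ty}).
Variable h : {mfun (TY * Ty)%type >-> TZ}.

Section noise.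
Context d1 d2 (Om1 : measurableType d1) (Om2 : measurableType d2).
Variables (q1 : {mfun (TB * Om1)%type >-> TY})
  (q2 : {mfun ((TB * TY) * Om2)%type >-> Ty}).

Definition refine_noise (x : (TB * TY) * Om2) : TZ := h (x.1.2, q2 x).

Let measurable_refine_noise : measurable_fun setT refine_noise.
Proof.
apply: measurableT_comp => //; apply: measurable_fun_pair => //.
exact: measurableT_comp.
Qed.

HB.instance Definition _ :=
  isMeasurableFun.Build _ _ _ _ refine_noise measurable_refine_noise.

Definition chain_noise (x : TB * (Om1 * Om2)) : TZ :=
  refine_noise ((x.1, q1 (x.1, x.2.1)), x.2.2).

Let measurable_chain_noise : measurable_fun setT chain_noise.
Proof.
have m21 : measurable_fun setT (fun x : TB * (Om1 * Om2) => x.2.1).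
  exact: measurableT_comp.
apply: (measurableT_comp measurable_refine_noise).
apply: measurable_fun_pair; last exact: measurableT_comp.
apply: measurable_fun_pair => //.
apply: measurableT_comp => //; exact: measurable_fun_pair.
Qed.

HB.instance Definition _ :=
  isMeasurableFun.Build _ _ _ _ chain_noise measurable_chain_noise.

End noise.

(** Sample [Y] from [B] with a first noise, then [y] from the pair of [B] and the sampled [Y] with
    an independent second noise. *)
Lemma outsourceable_pair (Z : {mfun T >-> TZ}) :
  outsourceable B Y -> outsourceable (pairRV B Y) y ->
  (forall t, Z t = h (Y t, y t)) -> outsourceable B Z.
Proof.
move=> [d1 [Om1 [lam1 [q1 BYq]]]] [d2 [Om2 [lam2 [q2 BYyq]]]] Zh.
exists _, _, (lam1 \x lam2), (chain_noise q1 q2).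
apply: outsources_rect => b c mb mc.
pose K z := lam2 [set om | c (refine_noise q2 (z, om))].
have mK : measurable_fun setT K by exact: measurable_noise_prob.
have K0 z : 0 <= K z by exact: measure_ge0.
have mbT : measurable (b `*` [set: TY]) by exact: measurableX.
(* [K] is the conditional probability that [Z] lies in [c], given [B] and [Y]; here [y] is
   integrated out. *)
transitivity (\int[P]_(t in pairRV B Y @^-1` (b `*` setT)) K (pairRV B Y t)).
  rewrite -(noisy_law_rect P lam2 (pairRV B Y) (pairRV B Y) (refine_noise q2) mbT mc).
  pose D := [set x : (TB * TY) * Ty | b x.1.1 /\ c (h (x.1.2, x.2))].
  have mD : measurable D.
    have -> : D = (fst \o fst) @^-1` b `&` (fun x => h (x.1.2, x.2)) @^-1` c by [].
    apply: measurableI; rewrite -[X in measurable X]setTI.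
      have : measurable_fun setT (fst \o fst : (TB * TY) * Ty -> TB).
        exact: measurableT_comp.
      exact.
    have : measurable_fun setT (fun x : (TB * TY) * Ty => h (x.1.2, x.2)).
      apply: measurableT_comp => //; apply: measurable_fun_pair => //.
      exact: measurableT_comp.
    exact.
  transitivity (distribution P (pairRV (pairRV B Y) y) D).
    rewrite /distribution /pushforward /=; congr (P _).
    by apply/seteqP; split => t /=; rewrite Zh.
  rewrite (BYyq _ mD) /noisy_law /distribution /pushforward /=.
  by congr ((P \x lam2)%E _); apply/seteqP; split => -[t om] /= => [[? ?]|[[? _] ?]].
(* Now the true [Y] is replaced by its sampled copy. *)
transitivity (\int[noisy_law P lam1 B B q1]_(z in b `*` setT) K z).
  transitivity (\int[distribution P (pairRV B Y)]_(z in b `*` setT) K z).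
    by rewrite ge0_integral_pushforward//; exact: measurable_funTS.
  by apply: eq_measure_integral => D mD _; exact: BYq.
rewrite integral_noisy_law_rect//; apply: eq_integral => t _.
rewrite (_ : [set _ | _] = setT); last by apply/seteqP; split.
apply: eq_integral => om _; rewrite /K /=; congr (lam2 _).
by rewrite /xsection; apply/seteqP; split => om2 /=; rewrite inE.
Qed.

End step.

End closure.

End outsourceable.

(** * Conditional quantiles of a real variable *)

Section real_outsourcing.
Context (R : realType).

(** On the set where [g < f] the nonnegative function [f - g] has integral at most 0; finiteness of
    the integral of [g] allows the cancellation. *)
Lemma ae_le_density d (T : measurableType d) (nu : {measure set T -> \bar R}%R)
    (f g : T -> R) :
  measurable_fun setT f -> measurable_fun setT g ->
  (forall x, 0 <= f x)%R -> (forall x, 0 <= g x)%R ->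
  \int[nu]_x (g x)%:E < +oo ->
  (forall b, measurable b -> \int[nu]_(x in b) (f x)%:E <= \int[nu]_(x in b) (g x)%:E) ->
  {ae nu, forall x, (f x <= g x)%R}.
Proof.
move=> mf mg f0 g0 goo fg.
pose N := [set x | (g x < f x)%R].
have mN : measurable N.
  rewrite -[X in measurable X]setTI.
  have := measurable_fun_ltr mg mf measurableT (Y := [set true]) I.
  by rewrite (_ : _ @^-1` _ = N)//.
have mfg : measurable_fun N (fun x => (f x - g x)%:E).
  by apply/measurable_EFinP/measurable_funTS; exact: measurable_funB.
have mg' : measurable_fun N (fun x => (g x)%:E).
  by apply/measurable_EFinP/measurable_funTS.
have fg0 x : N x -> 0 <= (f x - g x)%:E.
  by move=> Nx; rewrite lee_fin subr_ge0 ltW.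
have gN : \int[nu]_(x in N) (g x)%:E < +oo.
  apply: le_lt_trans goo; apply: ge0_subset_integral => //.
  - exact/measurable_EFinP.
  - by move=> x _; rewrite lee_fin.
have : \int[nu]_(x in N) ((g x)%:E + (f x - g x)%:E) <= \int[nu]_(x in N) (g x)%:E.
  apply: le_trans (fg N mN).
  by rewrite (eq_integral (fun x => (f x)%:E))// => x _; rewrite -EFinD addrC subrK.
rewrite ge0_integralD//; last by move=> x _; rewrite lee_fin.
have gfin : \int[nu]_(x in N) (g x)%:E \is a fin_num.
  by rewrite ge0_fin_numE//; apply: integral_ge0 => x _; rewrite lee_fin.
rewrite -[leRHS]adde0 leeD2lE// => I0.
have : \int[nu]_(x in N) `|(f x - g x)%:E| = 0.
  apply/eqP; rewrite eq_le; apply/andP; split; last exact: integral_ge0.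
  apply: le_trans I0; rewrite le_eqVlt; apply/orP; left; apply/eqP.
  by apply: eq_integral => x; rewrite inE => Nx; rewrite gee0_abs// fg0.
move=> /(ae_eq_integral_abs _ mN mfg); apply: filterS => x /= H.
rewrite leNgt; apply/negP => Nx.
by move: (H Nx) => -[] /eqP; rewrite subr_eq0 => /eqP E; move: Nx; rewrite E ltxx.
Qed.

Lemma uniform_prob_le (a : R) : (0 <= a <= 1)%R ->
  uniform_prob (@ltr01 R) [set u | (u <= a)%R] = a%:E.
Proof.
move=> /andP[a0 a1]; rewrite /uniform_prob integral_uniform_pdf.
have -> : [set u : R | (u <= a)%R] `&` `[0%R, 1%R] = `[0%R, a].
  apply/seteqP; split => x /=; rewrite !in_itv /=.
    by move=> [xa /andP[-> _]].
  by move=> /andP[-> xa]; split => //=; exact: le_trans xa a1.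
rewrite (eq_integral (cst 1)); last first.
  move=> x; rewrite inE /= in_itv /= => /andP[x0 xa]; rewrite /uniform_pdf.
  by rewrite x0 (le_trans xa a1) subr0 invr1.
rewrite integral_cst//= mul1e lebesgue_measure_itv /= lte_fin.
by move: a0; rewrite le_eqVlt => /predU1P[<-|->]; rewrite ?ltxx// sube0.
Qed.

(** A sequence, so that almost-everywhere statements about each rational hold simultaneously;
    indices that encode no rational give 0. *)
Definition rat_enum (n : nat) : R := ratr (odflt 0%R (unpickle n : option rat)).

Lemma rat_enum_dense (x y : R) : (x < y)%R -> exists n, (x < rat_enum n < y)%R.
Proof.
move=> /rat_in_itvoo[q]; rewrite in_itv /= => xqy.
by exists (pickle q); rewrite /rat_enum pickleK.
Qed.

Lemma measure_itvNyo_le (mu : {measure set R -> \bar R}%R) (x : R) (a : \bar R) :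
  (forall y, (y < x)%R -> mu `]-oo, y[%classic <= a) -> mu `]-oo, x[%classic <= a.
Proof.
move=> H.
pose F n := [set y : R | (y < x - n.+1%:R^-1)%R].
have FE n : F n = `]-oo, (x - n.+1%:R^-1)%R[%classic.
  by apply/seteqP; split => y /=; rewrite in_itv.
have mF n : measurable (F n) by rewrite FE.
have UF : \bigcup_n F n = `]-oo, x[%classic.
  apply/seteqP; split => [y [n _] /=|y /=]; rewrite in_itv /= => yx.
    by apply: lt_le_trans yx _; rewrite gerBl.
  have [n nxy] := ltr_add_invr yx.
  by exists n => //=; rewrite /F /= ltrBrDr.
have ndF : {homo F : n m / (n <= m)%N >-> (n <= m)%O}.
  move=> n m nm; apply/subsetPset => y /= ynx.
  apply: lt_le_trans ynx _; rewrite lerD2l lerN2 lef_pV2 ?posrE ?ltr0n//.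
  by rewrite ler_nat.
have /= := nondecreasing_cvg_mu (mu := mu) mF _ ndF; rewrite UF => /(_ (measurable_itv _)).
move=> muF; apply: (cvge_to_le muF).
by apply: nearW => n /=; rewrite FE; apply: H; rewrite gtrBl invr_gt0.
Qed.

(* The conditional quantile [inf {r | u <= F r z}] over the rationals [r]; the
   default 2 and the maximum with 0 keep it finite for variables in [0, 1]. *)
Section quantile.
Context dB (TB : measurableType dB) (F : nat -> TB -> R).
Hypothesis mF : forall n, measurable_fun setT (F n).

Definition quantile_candidate (x : TB * measurableTypeR R) (n : nat) : R :=
  if (x.2 <= F n x.1)%R then Num.max (rat_enum n) 0%R else 2%R.

Definition quantile (x : TB * measurableTypeR R) : R :=
  let _ := mF in fine (einfs (fun n => (quantile_candidate x n)%:E) 0%N).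

Let measurable_quantile : measurable_fun setT quantile.
Proof.
apply: measurableT_comp => //.
apply: (measurable_fun_einfs (f := fun n x => (quantile_candidate x n)%:E)) => n.
apply/measurable_EFinP; apply: measurable_fun_ifT => //.
by apply: measurable_fun_ler => //; exact: measurableT_comp.
Qed.

HB.instance Definition _ :=
  isMeasurableFun.Build _ _ _ _ quantile measurable_quantile.

(** Strict inequalities pass through an infimum, which is why open rays are used as test sets
    below. *)
Lemma quantile_lt x (r : R) :
  (quantile x < r)%R <-> exists n, (quantile_candidate x n < r)%R.
Proof.
have c0 n : (0 <= quantile_candidate x n)%R.
  by rewrite /quantile_candidate; case: ifP => // _; rewrite le_max lexx orbT.
set S := sdrop (fun n => (quantile_candidate x n)%:E) 0%N.
have S0 : 0 <= ereal_inf S.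
  by apply/ereal_infP => _ [n _ <-]; rewrite lee_fin.
have Sfin : ereal_inf S \is a fin_num.
  rewrite ge0_fin_numE//; apply: le_lt_trans (ltry (quantile_candidate x 0%N)).
  apply: ge_ereal_inf; exists (quantile_candidate x 0%N)%:E => //.
  by exists 0%N.
rewrite /quantile /einfs /= -/S -lte_fin fineK//; split.
- by move=> /ereal_inf_ltP[_ [n _ <-]]; rewrite lte_fin => nr; exists n.
- move=> [n nr]; apply/ereal_inf_ltP; exists (quantile_candidate x n)%:E => //.
  by exists n.
Qed.

End quantile.

End real_outsourcing.

Section unit_interval_outsourcing.
Context (R : realType) d (T : measurableType d) (P : probability T R).
Context dB (TB : measurableType dB) (B : {mfun T >-> TB}) (y : {mfun T >-> R}).
Hypothesis y01 : forall t, (0 <= y t <= 1)%R.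

Let U : probability (measurableTypeR R) R := uniform_prob (@ltr01 R).

Let mle n : measurable (y @^-1` `]-oo, rat_enum R n]).
Proof. exact: measurable_RV_preimage. Qed.

(** The properties of a distribution function on the rationals, for almost every [t].
    Right-continuity is replaced later by a squeeze between rationals. *)
Let ae_cdf (F : nat -> TB -> R) :
  (forall n, density (event_measure P B (mle n)) (distribution P B) (F n)) ->
  {ae P, forall t,
    [/\ (forall n m, (rat_enum R n <= rat_enum R m)%R -> (F n (B t) <= F m (B t))%R),
     (forall n, (F n (B t) <= 1)%R),
     (forall n, (rat_enum R n < 0)%R -> (F n (B t) <= 0)%R) &
     (forall n, (1 <= rat_enum R n)%R -> (1 <= F n (B t))%R)]}.
Proof.
move=> FP.
have mF n : measurable_fun setT (F n) by have [] := FP n.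
have F0 n z : (0 <= F n z)%R by have [] := FP n.
have FE n b : measurable b -> \int[distribution P B]_(z in b) (F n z)%:E =
    P (y @^-1` `]-oo, rat_enum R n] `&` B @^-1` b).
  by move=> mb; have [_ _ /(_ _ mb) <-] := FP n.
have int_cst (r : R) b : measurable b ->
    \int[distribution P B]_(z in b) (cst r z)%:E = r%:E * P (B @^-1` b).
  by move=> mb; rewrite (eq_integral (cst r%:E))// integral_cst.
have mB b : measurable b -> measurable (B @^-1` b).
  by move=> mb; exact: measurable_RV_preimage.
have mI n b : measurable b -> measurable (y @^-1` `]-oo, rat_enum R n] `&` B @^-1` b).
  by move=> mb; apply: measurableI; [exact: mle|exact: mB].
have Foo n : \int[distribution P B]_z (F n z)%:E < +oo.
  by rewrite FE// (le_lt_trans (probability_le1 _ (mI _ _ measurableT)))// ltry.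
have int_cst_oo (r : R) : \int[distribution P B]_z (cst r z)%:E < +oo.
  by rewrite int_cst// preimage_setT probability_setT mule1 ltry.
have H1 : {ae distribution P B, forall z, forall n m,
    (rat_enum R n <= rat_enum R m)%R -> (F n z <= F m z)%R}.
  apply: ae_foralln => n; apply: ae_foralln => m.
  have [nm|nm] := leP (rat_enum R n) (rat_enum R m); last first.
    by apply: filterE => z.
  suff : {ae distribution P B, forall z, (F n z <= F m z)%R} by apply: filterS.
  apply: ae_le_density => // b mb; rewrite !FE//; apply: le_measure.
  - by rewrite inE; exact: mI.
  - by rewrite inE; exact: mI.
  - move=> t /= [yn bt]; split => //; move: yn; rewrite !in_itv /= => yn.
    exact: le_trans nm.
have H2 : {ae distribution P B, forall z, forall n, (F n z <= 1)%R}.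
  apply: ae_foralln => n.
  apply: (@ae_le_density _ _ _ _ (F n) (cst 1%R)) => // b mb.
  rewrite FE// int_cst// mul1e; apply: le_measure; rewrite ?inE.
  - exact: mI.
  - exact: mB.
  - by move=> t [].
have H3 : {ae distribution P B, forall z, forall n,
    (rat_enum R n < 0)%R -> (F n z <= 0)%R}.
  apply: ae_foralln => n.
  have [n0|n0] := ltP (rat_enum R n) 0%R; last by apply: filterE.
  suff : {ae distribution P B, forall z, (F n z <= 0)%R} by apply: filterS.
  apply: (@ae_le_density _ _ _ _ (F n) (cst 0%R)) => // b mb.
  rewrite FE// int_cst// mul0e (_ : _ `&` _ = set0) ?measure0//.
  apply/seteqP; split => // t [] /=; rewrite in_itv /= => yn _.
  by have /andP[+ _] := y01 t; rewrite leNgt (le_lt_trans yn n0).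
have H4 : {ae distribution P B, forall z, forall n,
    (1 <= rat_enum R n)%R -> (1 <= F n z)%R}.
  apply: ae_foralln => n.
  have [n1|n1] := leP 1%R (rat_enum R n); last by apply: filterE.
  suff : {ae distribution P B, forall z, (1 <= F n z)%R} by apply: filterS.
  apply: (@ae_le_density _ _ _ _ (cst 1%R) (F n)) => // b mb.
  rewrite FE// int_cst// mul1e; apply: le_measure; rewrite ?inE.
  - exact: mB.
  - exact: mI.
  - move=> t bt; split => //=; rewrite in_itv /=.
    by have /andP[_ yt] := y01 t; exact: le_trans n1.
have {}H1 := ae_pushforward (measurable_funP B) H1.
have {}H2 := ae_pushforward (measurable_funP B) H2.
have {}H3 := ae_pushforward (measurable_funP B) H3.
have {}H4 := ae_pushforward (measurable_funP B) H4.
by apply: filterS3 H1 H2 (filterI H3 H4) => t ? ? [].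
Qed.

Lemma outsourceable_unit_interval : outsourceable P B y.
Proof.
have [F FP] : exists F : nat -> TB -> R, forall n,
    density (event_measure P B (mle n)) (distribution P B) (F n).
  pose dn n := cid (dominates_density
    (event_measure_dominates (P := P) (B := B) (mle n))).
  by exists (fun n => projT1 (dn n)) => n; exact: projT2 (dn n).
have mF n : measurable_fun setT (F n) by have [] := FP n.
have F0 n z : (0 <= F n z)%R by have [] := FP n.
have FE n b : measurable b -> \int[P]_(t in B @^-1` b) (F n (B t))%:E =
    P (y @^-1` `]-oo, rat_enum R n] `&` B @^-1` b).
  move=> mb; have [_ _ /(_ _ mb)] := FP n; rewrite ge0_integral_pushforward//.
  - by apply: measurable_funTS; exact/measurable_EFinP.
  - by move=> z _; rewrite lee_fin.
exists _, _, U, (quantile mF).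
pose k x t := U [set u | (quantile mF (B t, u) < x)%R].
have mset x z : measurable [set u | (quantile mF (z, u) < x)%R].
  have := measurable_noise_section (quantile mF) z (measurable_itv `]-oo, x[%R).
  by congr measurable; apply/seteqP; split => u /=; rewrite in_itv.
have mk x : measurable_fun setT (k x).
  have := measurable_noise_prob U (quantile mF) (measurable_itv `]-oo, x[%R).
  move=> /measurableT_comp /(_ (measurable_funP B)).
  rewrite (_ : _ \o B = k x)//; by apply/funext => t /=; congr (U _).
have mle' z n : measurable [set u : R | (u <= F n z)%R].
  have := measurable_itv `]-oo, F n z]%R.
  by congr measurable; apply/seteqP; split => u /=; rewrite in_itv.
have Fk x n : (rat_enum R n < x)%R -> {ae P, forall t, (F n (B t))%:E <= k x t}.
  move=> nx; apply: filterS (ae_cdf FP) => t [_ F1 Fn0 _].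
  (* A negative rational yields the candidate 0, which need not lie below [x]; in that case [F n] is
     at most 0. *)
  have [n0|n0] := ltP (rat_enum R n) 0%R.
    by apply: (@le_trans _ _ 0) => //; rewrite lee_fin; exact: Fn0.
  rewrite -(@uniform_prob_le _ (F n (B t))) ?F0 ?F1//.
  apply: le_measure; [by rewrite inE; exact: mle'|by rewrite inE; exact: mset|].
  move=> u /= uF.
  by apply/quantile_lt; exists n; rewrite /quantile_candidate /= uF max_l.
have kF x m : (x <= rat_enum R m)%R -> {ae P, forall t, k x t <= (F m (B t))%:E}.
  move=> xm; apply: filterS (ae_cdf FP) => t [Fmono F1 _ Fn1].
  have [m1|m1] := leP 1%R (rat_enum R m).
    by apply: le_trans (probability_le1 _ _) _ => //; rewrite lee_fin; exact: Fn1.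
  rewrite -(@uniform_prob_le _ (F m (B t))) ?F0 ?F1//.
  apply: le_measure; [by rewrite inE; exact: mset|by rewrite inE; exact: mle'|].
  move=> u /= /quantile_lt[n].
  rewrite /quantile_candidate /=; case: ifPn => [uF|_].
    rewrite gt_max => /andP[nx _]; apply: le_trans uF _; apply: Fmono.
    by rewrite (le_trans (ltW nx)).
  (* The default 2 cannot be the candidate: it would lie below [x], and x <= rat_enum m < 1. *)
  by move=> x2; exfalso; lra.
apply: outsources_rect => b c mb mc.
have mBb : measurable (B @^-1` b) by exact: measurable_RV_preimage.
rewrite -(noisy_law_rect P U B B (quantile mF) mb mc).
(* With [b] fixed, the true and the sampled law are compared as measures in [c], on rays generating
   the Borel sets. *)
pose nu := slice_measure (distribution P (pairRV B y)) mb.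
pose mu := slice_measure (noisy_law P U B B (quantile mF)) mb.
have muE x : mu `]-oo, x[%classic = \int[P]_(t in B @^-1` b) k x t.
  apply: etrans (noisy_law_rect P U B B (quantile mF) mb (measurable_itv _)) _.
  apply: eq_integral => t _.
  by congr (U _); apply/seteqP; split => u /=; rewrite in_itv.
have nuE n : nu `]-oo, rat_enum R n]%classic =
    \int[P]_(t in B @^-1` b) (F n (B t))%:E by rewrite FE// setIC.
have mFB n : measurable_fun (B @^-1` b) (fun t => (F n (B t))%:E).
  by apply/measurable_EFinP; apply: measurable_funTS; exact: measurableT_comp.
(* For x' < r < x with r rational, each measure of the ray below x' is at most the integral of the
   conditional distribution function at r, which is at most the other measure of the ray below x;
   then x' increases to x. *)
have nu_mu x : nu `]-oo, x[%classic = mu `]-oo, x[%classic.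
  apply/eqP; rewrite eq_le; apply/andP; split.
  - apply: measure_itvNyo_le => x' /rat_enum_dense[n /andP[x'n nx]].
    apply: (@le_trans _ _ (nu `]-oo, rat_enum R n]%classic)).
      apply: le_measure; rewrite ?inE//; apply: subset_itvl.
      by rewrite bnd_simp ltW.
    suff : \int[P]_(t in B @^-1` b) (F n (B t))%:E <=
        \int[P]_(t in B @^-1` b) k x t by rewrite -nuE -muE; exact.
    apply: ae_ge0_le_integral => //.
    - by move=> t _; rewrite lee_fin.
    - exact: measurable_funTS.
    - by apply: filterS (Fk _ _ nx) => t kt _.
  - apply: measure_itvNyo_le => x' /rat_enum_dense[n /andP[x'n nx]].
    apply: (@le_trans _ _ (nu `]-oo, rat_enum R n]%classic)); last first.
      apply: le_measure; rewrite ?inE//; apply: subset_itvl.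
      by rewrite bnd_simp.
    suff : \int[P]_(t in B @^-1` b) k x' t <=
        \int[P]_(t in B @^-1` b) (F n (B t))%:E by rewrite -nuE -muE; exact.
    apply: ae_ge0_le_integral => //.
    - exact: measurable_funTS.
    - by move=> t _; rewrite lee_fin.
    - by apply: filterS (kF _ _ (ltW x'n)) => t kt _.
have mG : @measurable _ R = <<s @RGenInftyO.G R >> by exact: RGenInftyO.measurableE.
have GI : setI_closed (@RGenInftyO.G R).
  move=> _ _ [x ->] [x' ->]; exists (Num.min x x').
  by apply/seteqP; split => z /=; rewrite !in_itv /= lt_min; [case=> -> ->|case/andP].
have Gn n : @RGenInftyO.G R `]-oo, n%:R%R[%classic by exists n%:R%R.
have cover : \bigcup_n `]-oo, n%:R%R[%classic = [set: R].
  apply/seteqP; split => // x _; exists (Num.bound `|x|%R) => //=.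
  by rewrite in_itv /= (le_lt_trans (ler_norm _))// archi_boundP.
have nu_mu_G A : @RGenInftyO.G R A -> nu A = mu A by move=> [x ->]; exact: nu_mu.
have nu_oo n : nu `]-oo, n%:R%R[%classic < +oo.
  apply: (@le_lt_trans _ _ 1); last exact: ltry.
  by apply: probability_le1; apply: measurableX.
exact: (measure_unique _ _ mG GI Gn cover
  (slice_measure (distribution P (pairRV B y)) mb)
  (slice_measure (noisy_law P U B B (quantile mF)) mb) nu_mu_G nu_oo _ mc).
Qed.

End unit_interval_outsourcing.

Section squash.
Context (R : realType).

(** A measurable injection into the unit interval with a measurable left inverse, built from [expR]
    and [ln] only. *)
Definition squash (x : R) : R := expR (- expR x).

Definition unsquash (x : R) : R := ln (- ln x).

Lemma squashK : cancel squash unsquash.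
Proof. by move=> x; rewrite /unsquash /squash expRK opprK expRK. Qed.

Lemma squash01 x : (0 <= squash x <= 1)%R.
Proof.
rewrite /squash expR_ge0 /= -(expR0 R) ler_expR oppr_le0.
exact: expR_ge0.
Qed.

Let measurable_squash : measurable_fun setT squash.
Proof.
apply: (measurableT_comp (@measurable_expR R)).
by apply: measurableT_comp => //; exact: measurable_expR.
Qed.

HB.instance Definition _ :=
  isMeasurableFun.Build _ _ _ _ squash measurable_squash.

Let measurable_unsquash : measurable_fun setT unsquash.
Proof.
apply: (measurableT_comp (@measurable_ln R)).
by apply: measurableT_comp => //; exact: measurable_ln.
Qed.

HB.instance Definition _ :=
  isMeasurableFun.Build _ _ _ _ unsquash measurable_unsquash.

End squash.

(** * From real variables to complex matrices *)

Section cmx_outsourcing.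
Context (R : realType) d (T : measurableType d) (P : probability T R).

Lemma outsourceable_real dB (TB : measurableType dB) (B : {mfun T >-> TB})
    (y : {mfun T >-> R}) : outsourceable P B y.
Proof.
apply: (outsourceable_comp (C := @squash R \o y) (h := @unsquash R)).
  by apply: outsourceable_unit_interval => t; exact: squash01.
by move=> t /=; rewrite squashK.
Qed.

Context (m n : nat).
Implicit Types (A : cmx R m n) (k : bool * 'I_m * 'I_n) (s : seq (bool * 'I_m * 'I_n)).

Definition cmx_coord k A : R :=
  if k.1.1 then cmx_re k.1.2 k.2 A else cmx_im k.1.2 k.2 A.

Let measurable_cmx_coord k : measurable_fun setT (cmx_coord k).
Proof.
rewrite /cmx_coord; case: k.1.1; [exact: measurable_cmx_re|exact: measurable_cmx_im].
Qed.

HB.instance Definition _ k :=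
  isMeasurableFun.Build _ _ _ _ (cmx_coord k) (measurable_cmx_coord k).

Definition cmx_of_coords (f : bool -> 'I_m -> 'I_n -> R) : cmx R m n :=
  (\matrix_(i, j) Complex (f true i j) (f false i j))%R.

Lemma cmx_coord_of_coords f b i j : cmx_coord (b, i, j) (cmx_of_coords f) = f b i j.
Proof. by case: b; rewrite /cmx_coord /cmx_re /cmx_im /= mxE. Qed.

Lemma cmx_coord_inj A A' : (forall k, cmx_coord k A = cmx_coord k A') -> A = A'.
Proof.
move=> AA'; apply/matrixP => i j.
have := AA' (true, i, j); have := AA' (false, i, j).
rewrite /cmx_coord /cmx_re /cmx_im /= => ImE ReE.
by apply/eqP; rewrite eq_complex ImE ReE !eqxx.
Qed.

Lemma measurable_fun_cmx_coord d' (T' : measurableType d') (f : T' -> cmx R m n) :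
  (forall k, measurable_fun setT (cmx_coord k \o f)) -> measurable_fun setT f.
Proof.
move=> mf; apply: measurable_fun_cmx => i j; first exact: (mf (true, i, j)).
exact: (mf (false, i, j)).
Qed.

(** Missing coordinates are set to 0 so that all stages of the induction on [s] stay in one
    measurable space. *)
Definition cmx_restrict s A : cmx R m n :=
  cmx_of_coords (fun b i j => if (b, i, j) \in s then cmx_coord (b, i, j) A else 0%R).

Let measurable_cmx_restrict s : measurable_fun setT (cmx_restrict s).
Proof.
apply: measurable_fun_cmx_coord => -[[b i] j].
rewrite (_ : _ \o _ =
    (fun A => if (b, i, j) \in s then cmx_coord (b, i, j) A else 0%R)).
  by case: ((b, i, j) \in s) => //; exact: measurable_cst.
by apply/funext => A /=; rewrite cmx_coord_of_coords.
Qed.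

HB.instance Definition _ s :=
  isMeasurableFun.Build _ _ _ _ (cmx_restrict s) (measurable_cmx_restrict s).

Definition cmx_update k (x : cmx R m n * R) : cmx R m n :=
  cmx_of_coords (fun b i j =>
    if (b, i, j) == k then x.2 else cmx_coord (b, i, j) x.1).

Let measurable_cmx_update k : measurable_fun setT (cmx_update k).
Proof.
apply: measurable_fun_cmx_coord => -[[b i] j].
rewrite (_ : _ \o _ =
    (fun x => if (b, i, j) == k then x.2 else cmx_coord (b, i, j) x.1)).
  by case: ((b, i, j) == k) => //; exact: measurableT_comp.
by apply/funext => A /=; rewrite cmx_coord_of_coords.
Qed.

HB.instance Definition _ k :=
  isMeasurableFun.Build _ _ _ _ (cmx_update k) (measurable_cmx_update k).

(* One real coordinate at a time, each generated given [B] and the coordinates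
   already produced. *)
Lemma outsourceable_cmx dB (TB : measurableType dB) (B : {mfun T >-> TB})
    (Y : {mfun T >-> cmx R m n}) : outsourceable P B Y.
Proof.
have H s : outsourceable P B (cmx_restrict s \o Y).
  elim: s => [|k s IHs].
    by exact: (@outsourceable_cst _ _ _ P _ _ B _ _ (cmx_of_coords (fun _ _ _ => 0%R))).
  apply: (outsourceable_pair (Y := cmx_restrict s \o Y) (y := cmx_coord k \o Y)
    (h := cmx_update k)).
  - exact: IHs.
  - exact: outsourceable_real.
  - move=> t; apply: cmx_coord_inj => -[[b i] j].
    rewrite /= /cmx_restrict /cmx_update !cmx_coord_of_coords in_cons.
    by case: eqVneq => //= <-.
pose s := enum {: bool * 'I_m * 'I_n}.
apply: (outsourceable_comp (C := cmx_restrict s \o Y) (h := cmx_restrict s)).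
  exact: H.
move=> t; apply: cmx_coord_inj => -[[b i] j].
by rewrite /= /cmx_restrict !cmx_coord_of_coords mem_enum.
Qed.

End cmx_outsourcing.

(** * Chain rules for mutual information *)

Section mfun_of.
Context d d' (T : measurableType d) (T' : measurableType d') (f : T -> T').
Hypothesis mf : measurable_fun setT f.

Definition mfun_of (x : T) : T' := let _ := mf in f x.

Let measurable_mfun_of : measurable_fun setT mfun_of.
Proof. exact: mf. Qed.

HB.instance Definition _ :=
  isMeasurableFun.Build _ _ _ _ mfun_of measurable_mfun_of.

End mfun_of.

(** * Markov properties as identities of laws *)

Section markov_laws.
Context (R : realType) d (T : measurableType d) (P : probability T R).
Context dS dC (TS : measurableType dS) (TC : measurableType dC).
Context dO (Om : measurableType dO) (lam : probability Om R).
Variables (S : {mfun T >-> TS}) (C : {mfun T >-> TC}).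
Variable q : {mfun (TS * Om)%type >-> TC}.
Hypothesis SCq : outsources P lam S C q.

Lemma measure_rect3l_unique d1 d2 d3 (T1 : measurableType d1)
    (T2 : measurableType d2) (T3 : measurableType d3)
    (m1 m2 : probability (T1 * T2 * T3)%type R) :
  (forall a b c, measurable a -> measurable b -> measurable c ->
    m1 ((a `*` b) `*` c) = m2 ((a `*` b) `*` c)) ->
  forall D, measurable D -> m1 D = m2 D.
Proof.
move=> m12 D mD.
pose l (z : T1 * T2 * T3) : T1 * (T2 * T3) := (z.1.1, (z.1.2, z.2)).
pose r (z : T1 * (T2 * T3)) : T1 * T2 * T3 := ((z.1, z.2.1), z.2.2).
have ml : measurable_fun setT l.
  apply: measurable_fun_pair; first exact: measurableT_comp.
  by apply: measurable_fun_pair => //; exact: measurableT_comp.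
have mr : measurable_fun setT r.
  apply: measurable_fun_pair; last exact: measurableT_comp.
  by apply: measurable_fun_pair => //; exact: measurableT_comp.
have mrD : measurable (r @^-1` D) by rewrite -[X in measurable X]setTI; exact: mr.
have lr : l @^-1` (r @^-1` D) = D by apply/seteqP; split => -[[]].
rewrite -lr.
apply: (@measure_rect3_unique _ _ _ _ _ _ _ (distribution m1 (mfun_of ml))
  (distribution m2 (mfun_of ml))) mrD => [|a b c ma mb mc].
  by rewrite (le_lt_trans (probability_le1 _ measurableT))// ltry.
have E : l @^-1` (a `*` (b `*` c)) = (a `*` b) `*` c.
  by apply/seteqP; split => -[[x y] z] /=; [case=> ? []|case=> -[]].
rewrite /= /distribution /pushforward /=.
by apply: etrans (etrans (m12 _ _ _ ma mb mc) _); rewrite -E.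
Qed.

(** The factorization of P(A in a, C in c | S), integrated over an event of [S], is the value of the
    resampled law on a rectangle. *)
Lemma markov_chain_noisy_law dA (TA : measurableType dA) (A : {mfun T >-> TA}) :
  markov_chain (P := P) A S C ->
  forall D, measurable D ->
    distribution P (pairRV (pairRV A S) C) D = noisy_law P lam (pairRV A S) S q D.
Proof.
move=> ASC; apply: measure_rect3l_unique => a b c ma mb mc.
rewrite noisy_law_rect//; last exact: measurableX.
have mA := measurable_RV_preimage A ma.
have mC := measurable_RV_preimage C mc.
have mAC : measurable (A @^-1` a `&` C @^-1` c) by exact: measurableI.
have [mAC' ACE] := cond_probP P S mAC.
have [mA' _] := cond_probP P S mA; have [mC' _] := cond_probP P S mC.
transitivity (P (A @^-1` a `&` C @^-1` c `&` S @^-1` b)).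
  rewrite /distribution /pushforward /=; congr (P _).
  by apply/seteqP; split => t /=; [case=> -[]|case=> -[]].
rewrite -(ACE _ mb).
have := integral_cond_prob_mul SCq mA mb mc; rewrite (_ : _ `&` _ =
    pairRV A S @^-1` (a `*` b)) => [<-|]; last by apply/seteqP; split.
apply: ae_eq_integral => //.
- by apply/measurable_EFinP/measurable_funTS.
- by apply/measurable_EFinP/measurable_funTS; exact: measurable_funM.
- by apply: filterS (ASC _ _ ma mc) => z -> _.
Qed.

(** The locality hypothesis conditions on the finer variable [E]; as [A] is a function of [E],
    events of [A] and [S] pull back to events of [E] and [S]. *)
Lemma local_noisy_law dE dA (TE : measurableType dE) (TA : measurableType dA)
    (E : {mfun T >-> TE}) (A : {mfun T >-> TA}) (phi : TE -> TA) :
  measurable_fun setT phi -> (forall t, A t = phi (E t)) ->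
  (forall c, measurable c ->
    {ae distribution P (pairRV E S), forall z,
      cond_prob (P := P) (pairRV E S) (C @^-1` c) z =
      cond_prob (P := P) S (C @^-1` c) z.2}) ->
  forall D, measurable D ->
    distribution P (pairRV (pairRV A S) C) D = noisy_law P lam (pairRV A S) S q D.
Proof.
move=> mphi Aphi loc.
apply: measure_rect_unique => [|v c mv mc].
  by rewrite (le_lt_trans (probability_le1 _ measurableT))// ltry.
apply: etrans (esym (noisy_law_rect _ _ _ _ _ mv mc)).
pose v' := [set z : TE * TS | v (phi z.1, z.2)].
have mv' : measurable v'.
  rewrite -[X in measurable X]setTI.
  have : measurable_fun setT (fun z : TE * TS => (phi z.1, z.2)).
    by apply: measurable_fun_pair => //; exact: measurableT_comp.
  exact.
have mC := measurable_RV_preimage C mc.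
have [mW WE] := cond_probP P (pairRV E S) mC.
have v'E : pairRV E S @^-1` v' = pairRV A S @^-1` v.
  by apply/seteqP; split => t /=; rewrite /pairRV /v' /= Aphi.
transitivity (P (C @^-1` c `&` pairRV E S @^-1` v')).
  by rewrite v'E setIC.
rewrite -(WE _ mv').
have mn : measurable_fun setT (fun z : TE * TS => noise_prob lam q c z.2).
  by apply: measurableT_comp => //; exact: measurable_noise_probR.
have n0 (z : TE * TS) : 0 <= (noise_prob lam q c z.2)%:E.
  by rewrite lee_fin noise_prob_ge0.
transitivity (\int[distribution P (pairRV E S)]_(z in v') (noise_prob lam q c z.2)%:E).
  apply: ae_eq_integral => //.
  - by apply/measurable_EFinP/measurable_funTS.
  - by apply/measurable_EFinP/measurable_funTS.
  (* The law of [S] is the image under [snd] of that of the pair, so null sets of the former pull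
     back. *)
  - have H : {ae distribution P (pairRV E S), forall z,
        cond_prob (P := P) S (C @^-1` c) z.2 = noise_prob lam q c z.2}.
      exact: (ae_pushforward (mu := distribution P (pairRV E S))
        measurable_snd (ae_cond_prob_noise SCq mc)).
    by apply: filterS2 (loc _ mc) H => z -> -> _.
rewrite ge0_integral_pushforward//; last first.
  by apply/measurable_EFinP/measurable_funTS.
by rewrite v'E; apply: eq_integral => t _; rewrite /= noise_probE.
Qed.

End markov_laws.

Section information_noisy_law.
Context (R : realType) d (T : measurableType d) (P : probability T R).

Lemma cond_mutual_info_ge0 dA dB dC (TA : measurableType dA)
    (TB : measurableType dB) (TC : measurableType dC) (A : {mfun T >-> TA})
    (B : {mfun T >-> TB}) (C : {mfun T >-> TC}) :
  0 <= cond_mutual_info (P := P) A C B.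
Proof.
by rewrite /cond_mutual_info; case: pselect => // e; exact: kl_div_ge0.
Qed.

(** Puts the conditional information into the form required by [kl_div_noisy_chain]: [e] reorders
    [V] into the conditioning variable and the other argument. *)
Lemma cond_mutual_info_noisy_law dA dB dC dV dS (TA : measurableType dA)
    (TB : measurableType dB) (TC : measurableType dC) (TV : measurableType dV)
    (TS : measurableType dS) (A : {mfun T >-> TA})
    (B : {mfun T >-> TB}) (C : {mfun T >-> TC}) (V : {mfun T >-> TV})
    (S : {mfun T >-> TS}) dO (Om : measurableType dO) (lam : probability Om R)
    (q0 : {mfun (TB * Om)%type >-> TC}) (q : {mfun (TS * Om)%type >-> TC})
    (e : TV -> TB * TA) (e' : TB * TA -> TV) :
  measurable_fun setT e -> measurable_fun setT e' -> cancel e e' ->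
  (forall t, e (V t) = (B t, A t)) ->
  outsources P lam B C q0 -> (forall t om, q (S t, om) = q0 (B t, om)) ->
  cond_mutual_info (P := P) A C B =
  kl_div (distribution P (pairRV V C)) (noisy_law P lam V S q).
Proof.
move=> me me' ee' eV BCq qq0; rewrite (cond_mutual_info_noisy A BCq).
pose r (z : TV * TC) : TB * (TA * TC) := ((e z.1).1, ((e z.1).2, z.2)).
pose s (z : TB * (TA * TC)) : TV * TC := (e' (z.1, z.2.1), z.2.2).
have me1 : measurable_fun setT (fun z : TV * TC => e z.1) by exact: measurableT_comp.
have mr : measurable_fun setT r.
  apply: measurable_fun_pair; first exact: measurableT_comp.
  by apply: measurable_fun_pair => //; exact: measurableT_comp.
have ms : measurable_fun setT s.
  apply: measurable_fun_pair; last exact: measurableT_comp.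
  apply: measurableT_comp => //.
  by apply: measurable_fun_pair => //; exact: measurableT_comp.
have rs : cancel (mfun_of mr) s.
  by move=> [v c]; rewrite /s /mfun_of /r /= -surjective_pairing ee'.
rewrite -(kl_div_cancel _ _ ms rs).
have rE t c : r (V t, c) = (B t, (A t, c)) by rewrite /r /= eV.
apply: kl_div_eq_measure => D mD.
- have E : pairRV B (pairRV A C) = r \o pairRV V C :> (_ -> _).
    by apply/funext => t /=; rewrite rE.
  exact: (congr1 (fun f : T -> _ => P (f @^-1` D)) E).
- have E : pairRV (noiseless B) (pairRV (noiseless A) (noisy B q0)) =
      r \o pairRV (noiseless V) (noisy S q) :> (T * Om -> _).
    apply/funext => -[t om] /=.
    by rewrite [in RHS]/pairRV rE; congr (_, (_, _)); apply/esym; exact: qq0.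
  exact: (congr1 (fun f : T * Om -> _ => (P \x lam) (f @^-1` D)) E).
Qed.

(** A product law is a noisy law whose noise is an independent copy of [C] and whose kernel ignores
    [A]. *)
Lemma mutual_info_noisy_law dA dC (TA : measurableType dA) (TC : measurableType dC)
    (A : {mfun T >-> TA}) (C : {mfun T >-> TC})
    (q : {mfun (TA * TC)%type >-> TC}) :
  q =1 snd ->
  mutual_info (P := P) A C =
  kl_div (distribution P (pairRV A C)) (noisy_law P (distribution P C) A A q).
Proof.
move=> q2; apply: kl_div_eq_measure => D mD; first exact: erefl.
apply: product_measure_unique mD => a c ma mc.
have E : pairRV (noiseless A) (noisy A q) @^-1` (a `*` c) = A @^-1` a `*` c.
  by apply/seteqP; split => -[t om] /=; rewrite /noisy q2.
have mAa : measurable (A @^-1` a) by exact: measurable_RV_preimage.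
apply: etrans (product_measure1E P (distribution P C) mAa mc).
exact: (congr1 (P \x distribution P C) E).
Qed.

End information_noisy_law.

Section information_chain_rules.
Context (R : realType) d (T : measurableType d) (P : probability T R).

(** The reference kernel draws [Y] from its own law, whatever the pair of [A] and [S]; [p] keeps [S]
    and [u] keeps [A]. *)
Lemma mutual_info_markov_chain dA dS (TA : measurableType dA)
    (TS : measurableType dS) m n (A : {mfun T >-> TA}) (S : {mfun T >-> TS})
    (Y : {mfun T >-> cmx R m n}) :
  markov_chain (P := P) A S Y ->
  mutual_info (P := P) S Y =
  mutual_info (P := P) A Y + cond_mutual_info (P := P) S Y A.
Proof.
move=> ASY.
have [d1 [Om1 [lam1 [q1 SYq1]]]] := outsourceable_cmx P S Y.
have [d2 [Om2 [lam2 [q2 AYq2]]]] := outsourceable_cmx P A Y.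
rewrite (@mutual_info_noisy_law _ _ _ P _ _ _ _ S Y (mfun_of measurable_snd))//.
rewrite (@mutual_info_noisy_law _ _ _ P _ _ _ _ A Y (mfun_of measurable_snd))//.
rewrite (cond_mutual_info_noisy_law (V := pairRV A S) (S := A) (q := q2)
  (e := id) (e' := id) _ _ _ _ AYq2)//.
pose V : {mfun T >-> (TA * TS)%type} := pairRV A S.
pose p : {mfun (TA * TS)%type >-> TS} := mfun_of measurable_snd.
pose u : {mfun (TA * TS)%type >-> TA} := mfun_of measurable_fst.
have VY D : measurable D ->
    distribution P (pairRV V Y) D = noisy_law P lam1 V (p \o V) q1 D.
  by move=> mD; exact: etrans (markov_chain_noisy_law SYq1 ASY mD) erefl.
have UY D : measurable D -> distribution P (pairRV (u \o V) Y) D =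
    noisy_law P lam2 (u \o V) (u \o V) q2 D.
  exact: (AYq2 D).
have chain := kl_div_noisy_chain (p := p) (u := u) (distribution P Y)
  (qS := mfun_of measurable_snd) (qU := mfun_of measurable_snd)
  (fun _ _ => erefl) VY UY.
apply: etrans (etrans chain _); last congr (_ + _).
- by apply: kl_div_eq_measure => D mD; exact: erefl.
- by apply: kl_div_eq_measure => D mD; exact: erefl.
- by apply: kl_div_eq_measure => D mD; exact: erefl.
Qed.

(** The reference kernel draws [Y] given [X], which both projections retain; [p] forgets [U] and [u]
    forgets [A]. *)
Lemma cond_mutual_info_local dE dU dA dX (TE : measurableType dE)
    (TU : measurableType dU) (TA : measurableType dA) (TX : measurableType dX)
    m n (E : {mfun T >-> TE}) (U : {mfun T >-> TU}) (A : {mfun T >-> TA})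
    (X : {mfun T >-> TX}) (Y : {mfun T >-> cmx R m n}) (phi : TE -> TU) :
  measurable_fun setT phi -> (forall t, U t = phi (E t)) ->
  (forall c, measurable c ->
    {ae distribution P (pairRV E (pairRV A X)), forall z,
      cond_prob (P := P) (pairRV E (pairRV A X)) (Y @^-1` c) z =
      cond_prob (P := P) (pairRV A X) (Y @^-1` c) z.2}) ->
  cond_mutual_info (P := P) A Y X =
  cond_mutual_info (P := P) U Y X + cond_mutual_info (P := P) A Y (pairRV U X).
Proof.
move=> mphi Uphi loc.
have [d0 [Om [lam [q XYq]]]] := outsourceable_cmx P X Y.
have [d1 [Om1 [lam1 [q1 SYq1]]]] := outsourceable_cmx P (pairRV A X) Y.
have [d2 [Om2 [lam2 [q2 UXYq2]]]] := outsourceable_cmx P (pairRV U X) Y.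
have mswap d1' d2' (T1 : measurableType d1') (T2 : measurableType d2') :
    measurable_fun setT (fun z : T1 * T2 => (z.2, z.1)).
  exact: measurable_fun_pair.
have mq2 d' (T' : measurableType d') :
    measurable_fun setT (fun z : (T' * TX) * Om => q (z.1.2, z.2)).
  apply: measurableT_comp => //; apply: measurable_fun_pair => //.
  exact: measurableT_comp.
have m22 : measurable_fun setT (fun v : TU * (TA * TX) => v.2.2).
  exact: measurableT_comp.
have m21 : measurable_fun setT (fun v : TU * (TA * TX) => v.2.1).
  exact: measurableT_comp.
have mu : measurable_fun setT (fun v : TU * (TA * TX) => (v.1, v.2.2)).
  exact: measurable_fun_pair.
have me : measurable_fun setT (fun v : TU * (TA * TX) => ((v.1, v.2.2), v.2.1)).
  exact: measurable_fun_pair.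
have me' : measurable_fun setT (fun w : (TU * TX) * TA => (w.1.1, (w.2, w.1.2))).
  apply: measurable_fun_pair; first exact: measurableT_comp.
  by apply: measurable_fun_pair => //; exact: measurableT_comp.
rewrite (cond_mutual_info_noisy_law (V := pairRV A X) (S := pairRV A X)
  (q := mfun_of (mq2 _ TA)) (mswap _ _ TA TX) (mswap _ _ TX TA) _ _ XYq)//;
  last by case.
rewrite (cond_mutual_info_noisy_law (V := pairRV U X) (S := pairRV U X)
  (q := mfun_of (mq2 _ TU)) (mswap _ _ TU TX) (mswap _ _ TX TU) _ _ XYq)//;
  last by case.
rewrite (cond_mutual_info_noisy_law (V := pairRV U (pairRV A X)) (S := pairRV U X)
  (q := q2) me me' _ _ UXYq2)//; last by case=> ? [].
pose V : {mfun T >-> (TU * (TA * TX))%type} := pairRV U (pairRV A X).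
pose p : {mfun (TU * (TA * TX))%type >-> (TA * TX)%type} := mfun_of measurable_snd.
pose u : {mfun (TU * (TA * TX))%type >-> (TU * TX)%type} := mfun_of mu.
have VY D : measurable D ->
    distribution P (pairRV V Y) D = noisy_law P lam1 V (p \o V) q1 D.
  by move=> mD; exact: etrans (local_noisy_law SYq1 mphi Uphi loc mD) erefl.
have UY D : measurable D -> distribution P (pairRV (u \o V) Y) D =
    noisy_law P lam2 (u \o V) (u \o V) q2 D.
  exact: (UXYq2 D).
have chain := kl_div_noisy_chain (p := p) (u := u) lam (qS := mfun_of (mq2 _ TA))
  (qU := mfun_of (mq2 _ TU)) (fun _ _ => erefl) VY UY.
apply: etrans (etrans chain _); last congr (_ + _).
- by apply: kl_div_eq_measure => D mD; exact: erefl.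
- by apply: kl_div_eq_measure => D mD; exact: erefl.
- by apply: kl_div_eq_measure => D mD; exact: erefl.
Qed.

End information_chain_rules.

Theorem proposition1 (R : realType)
    (d : measure_display) (T : measurableType d) (P : probability T R)
    (n L mc ms : nat) (TaskC TaskS KbC KbS Policy : Type)
    (dSc : measure_display) (SpSc : measurableType dSc)
    (dUc : measure_display) (SpUc : measurableType dUc)
    (dE : measure_display) (SpE : measurableType dE)
    (dUs : measure_display) (SpUs : measurableType dUs)
    (dPh : measure_display) (SpPh : measurableType dPh)
    (M : isac_model P n L mc ms TaskC TaskS KbC KbS Policy
           SpSc SpUc SpE SpUs SpPh)
    (Omega : semantic_context TaskC TaskS KbC KbS)
    (pi : Policy) (pi_feasible : feasible M pi) :
  let X : {RV P >-> cmx R n L} := signal M pi in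
  let Uc : {RV P >-> SpUc} := comm_target M Omega in
  let Us : {RV P >-> SpUs} := sens_target M Omega in
  let Pphy : {RV P >-> SpPh} := phy_param M in
  let Yc : {RV P >-> cmx R mc L} := comm_obs M pi in
  let Ys : {RV P >-> cmx R ms L} := sens_obs M pi in
  let I_c_sem := mutual_info Uc Yc in
  let I_s_sem := cond_mutual_info Us Ys X in
  let I_c_phy := mutual_info X Yc in
  let I_s_phy := cond_mutual_info Pphy Ys X in
  let Delta_c := cond_mutual_info X Yc Uc in
  let Delta_s := cond_mutual_info (P := P) Pphy Ys (pairRV Us X) in
  sens_local M pi ->
  markov_chain Uc X Yc ->
  cond_mutual_info (P := P) Us Ys (pairRV Pphy X) = 0 ->
  [/\ I_c_phy = I_c_sem + Delta_c, I_s_phy = I_s_sem + Delta_s,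
      I_c_sem <= I_c_phy & I_s_sem <= I_s_phy].
Proof.
move=> X Uc Us Pphy Yc Ys I_c_sem I_s_sem I_c_phy I_s_phy Delta_c Delta_s.
move=> loc ucxyc _.
have Ec : I_c_phy = I_c_sem + Delta_c by exact: mutual_info_markov_chain.
have Es : I_s_phy = I_s_sem + Delta_s.
  (* The target [Us] is a function of the environment, on which [sens_local] conditions. *)
  apply: (@cond_mutual_info_local _ _ _ P _ _ _ _ _ _ _ _ _ _ (env M) Us Pphy X Ys
    (phi_s M (sens_task Omega) (sens_kb Omega))) => //.
split => //.
- by rewrite Ec leeDl// cond_mutual_info_ge0.
- by rewrite Es leeDl// cond_mutual_info_ge0.
Qed.
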